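(* Let $K$ be a field of characteristic zero, $L$ a field extension of $K$, and $\mathfrak{g}$ a finite-dimensional Lie algebra over $K$. Then $\mathrm{cni}^+(L\otimes_K\mathfrak{g})=L\otimes_K\mathrm{cni}^+(\mathfrak{g})$, where $L\otimes_K\mathfrak{g}$ is viewed as a Lie algebra over $L$. In particular, $\mathfrak{g}$ is essentially contractable if and only if $L\otimes_K\mathfrak{g}$ is essentially contractable.
   Context: For a finite-dimensional Lie algebra $\mathfrak{g}$ over a field $F$ of characteristic zero, the uncontractable radical $\mathrm{cni}^+(\mathfrak{g})$ is the intersection of the kernels of all $F$-linear derivations $\mathfrak{g}\to\mathfrak{g}$ that are diagonalizable over $F$ with all eigenvalues in $\mathbf{N}=\{0,1,2,\dots\}$. The Lie algebra $\mathfrak{g}$ is called essentially contractable if $\mathrm{cni}^+(\mathfrak{g})=\{0\}$. *)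

(* Defs.v *)
From HB Require Import structures.
From mathcomp Require Import all_boot all_order all_algebra.
From mathcomp Require Import boolp classical_sets.

Set Implicit Arguments.
Unset Strict Implicit.
Unset Printing Implicit Defensive.

Import GRing.Theory.
Local Open Scope ring_scope.
Local Open Scope classical_set_scope.

Reserved Notation "[ 'Lie' x , y ]"
  (at level 0, x, y at level 99, format "[ 'Lie'  x ,  y ]").

(* Finite-dimensionality is part of the Vector structure. *)
HB.mixin Record Vector_isLieAlgebra (K : fieldType) (g : Type)
    of Vector K g := {
  bracket : g -> g -> g;
  bracket_linearl : forall y, linear (bracket^~ y);
  bracket_linearr : forall x, linear (bracket x);
  bracketxx : forall x, bracket x x = 0;
  bracket_jacobi : forall x y z,
    bracket x (bracket y z) + bracket y (bracket z x)
      + bracket z (bracket x y) = 0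
}.

#[short(type="finLieType")]
HB.structure Definition FinLie (K : fieldType) :=
  {g of Vector_isLieAlgebra K g & Vector K g}.

Notation "[ 'Lie' x , y ]" := (bracket x y) : ring_scope.

Section BracketTheory.
Variables (K : fieldType) (g : finLieType K).

HB.instance Definition _ := bilinear_isBilinear.Build K g g g *:%R *:%R
  (@bracket K g) (bracket_linearl, bracket_linearr).

Lemma bracketC (x y : g) : [Lie x, y] = - [Lie y, x].
Proof.
apply/eqP; rewrite -addr_eq0; have := bracketxx (x + y).
by rewrite linearDl !linearDr /= !bracketxx add0r addr0 => ->.
Qed.

End BracketTheory.

Section UncontractableRadical.
Variables (K : fieldType) (g : finLieType K).
Implicit Type D : 'End(g).

Definition derivation D :=
  forall x y : g, D [Lie x, y] = [Lie D x, y] + [Lie x, D y].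

Definition diagonalizable_end D :=
  exists2 b : (\dim {:g}).-tuple g, basis_of {:g} b &
    forall x, x \in (b : seq g) -> exists a : K, D x = a *: x.

Definition nat_eigenvalues D :=
  forall a : K, passmx.leigenvalue D a -> exists n : nat, a = n%:R.

Definition cni_plus : set g :=
  \bigcap_(D in [set D : 'End(g) | [/\ derivation D, diagonalizable_end D
                                     & nat_eigenvalues D]])
    [set x | x \in lker D].

Definition essentially_contractable := cni_plus = [set 0].

End UncontractableRadical.

Arguments cni_plus {K} g.
Arguments essentially_contractable {K} g.

(* Extension of scalars L (x)_K g along a field extension f : K -> L of        *)
(* arbitrary degree. It is modelled by L-coordinates with respect to a fixed  *)
(* K-basis of g; tens_universal, tensZ and bracket_tens below show that it is *)
(* the tensor product over K with its usual structure of Lie algebra over L.  *)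
Definition scalar_ext (K L : fieldType) (f : {rmorphism K -> L})
  (g : finLieType K) : Type := 'rV[L]_(\dim {:g}).

Arguments scalar_ext {K L} f g.

Section ScalarExtension.
Variables (K L : fieldType) (f : {rmorphism K -> L}) (g : finLieType K).
Local Notation "'LG'" := (scalar_ext f g).
Local Notation n := (\dim {:g}).

HB.instance Definition _ := Vector.copy LG 'rV[L]_n.

Definition tens (a : L) (x : g) : LG :=
  \row_i (a * f (coord (vbasis {:g}) i x)).

Definition gbasis (i : 'I_n) : g := (vbasis {:g})`_i.

Definition ext_bracket (u v : LG) : LG :=
  \sum_i \sum_j tens (u 0 i * v 0 j) [Lie gbasis i, gbasis j].

Lemma gbasisE x : x = \sum_i coord (vbasis {:g}) i x *: gbasis i.
Proof. by apply: coord_vbasis; rewrite memvf. Qed.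

Lemma coord_gbasis i j : coord (vbasis {:g}) i (gbasis j) = (i == j)%:R.
Proof. by rewrite coord_free ?(basis_free (vbasisP _)) // eq_sym. Qed.

Lemma tensDl a b x : tens (a + b) x = tens a x + tens b x.
Proof. by apply/rowP => i; rewrite !mxE mulrDl. Qed.

Lemma tensDr a x y : tens a (x + y) = tens a x + tens a y.
Proof. by apply/rowP => i; rewrite !mxE linearD rmorphD mulrDr. Qed.

(* L is a K-module through f. *)
Lemma tens_balanced a k x : tens (a * f k) x = tens a (k *: x).
Proof. by apply/rowP => i; rewrite !mxE linearZ rmorphM mulrA. Qed.

Lemma tensZ c a x : c *: tens a x = tens (c * a) x.
Proof. by apply/rowP => i; rewrite !mxE mulrA. Qed.

Lemma tens0r a : tens a 0 = 0.
Proof. by apply/rowP => i; rewrite !mxE linear0 rmorph0 mulr0. Qed.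

Lemma tens_sumr a (I : Type) (r : seq I) (F : I -> g) :
  tens a (\sum_(i <- r) F i) = \sum_(i <- r) tens a (F i).
Proof. exact: (big_morph (tens a) (tensDr a) (tens0r a)). Qed.

Lemma tensN a x : tens a (- x) = - tens a x.
Proof. by apply/eqP; rewrite -addr_eq0 -tensDr addNr tens0r. Qed.

Lemma tens_gbasis (u : LG) : u = \sum_i tens (u 0 i) (gbasis i).
Proof.
rewrite [LHS]row_sum_delta; apply: eq_bigr => i _.
by apply/rowP => j; rewrite !mxE coord_gbasis rmorph_nat.
Qed.

Lemma tens_universal (W : zmodType) (phi : L -> g -> W) :
    (forall a b x, phi (a + b) x = phi a x + phi b x) ->
    (forall a x y, phi a (x + y) = phi a x + phi a y) ->
    (forall a k x, phi (a * f k) x = phi a (k *: x)) ->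
  exists! H : LG -> W,
    (forall u v, H (u + v) = H u + H v) /\ (forall a x, H (tens a x) = phi a x).
Proof.
move=> phiDl phiDr phiM.
have phi0 a : phi a 0 = 0 by apply: (addrI (phi a 0)); rewrite -phiDr !addr0.
exists (fun u : LG => \sum_i phi (u 0 i) (gbasis i)); split.
  split=> [u v | a x].
    by rewrite -big_split; apply: eq_bigr => i _; rewrite mxE phiDl.
  rewrite [in RHS](gbasisE x) (big_morph (phi a) (phiDr a) (phi0 a)).
  by apply: eq_bigr => i _; rewrite !mxE phiM.
move=> H [HD Ht]; apply: funext => u.
have H0 : H 0 = 0 by apply: (addrI (H 0)); rewrite -HD !addr0.
rewrite [in RHS](tens_gbasis u) (big_morph H HD H0).
by apply: eq_bigr => i _; rewrite Ht.
Qed.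

Lemma tens_ind (P : LG -> Prop) :
    (forall u v, P u -> P v -> P (u + v)) -> (forall a x, P (tens a x)) ->
  forall u, P u.
Proof.
move=> PD Pt u; rewrite (tens_gbasis u); apply: (big_ind P) => //.
by rewrite -(tens0r 0).
Qed.

Lemma ext_bracket_linearl v : linear (ext_bracket^~ v).
Proof.
move=> c u w; rewrite /ext_bracket scaler_sumr -big_split.
apply: eq_bigr => i _ /=; rewrite scaler_sumr -big_split.
by apply: eq_bigr => j _ /=; rewrite !mxE tensZ -tensDl mulrDl mulrA.
Qed.

Lemma ext_bracket_linearr v : linear (ext_bracket v).
Proof.
move=> c u w; rewrite /ext_bracket scaler_sumr -big_split.
apply: eq_bigr => i _ /=; rewrite scaler_sumr -big_split.
by apply: eq_bigr => j _ /=; rewrite !mxE tensZ -tensDl mulrDr mulrCA.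
Qed.

HB.instance Definition _ := bilinear_isBilinear.Build L LG LG LG *:%R *:%R
  ext_bracket (ext_bracket_linearl, ext_bracket_linearr).

Lemma ext_bracket_tens a b x y :
  ext_bracket (tens a x) (tens b y) = tens (a * b) [Lie x, y].
Proof.
rewrite [in RHS](gbasisE x) linear_sumlz tens_sumr; apply: eq_bigr => i _.
rewrite [in RHS](gbasisE y) linear_sumr tens_sumr; apply: eq_bigr => j _.
by rewrite linearZr_LR linearZl_LR /= -!tens_balanced !mxE mulrACA -!mulrA (mulrC (f _) (f _)).
Qed.

Lemma ext_bracketxx u : ext_bracket u u = 0.
Proof.
pose t (p : 'I_n * 'I_n) := tens (u 0 p.1 * u 0 p.2) [Lie gbasis p.1, gbasis p.2].
have tC p : t (p.2, p.1) = - t p by rewrite /t -tensN -bracketC mulrC.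
rewrite /ext_bracket pair_big /= -/t (bigID (fun p : 'I_n * 'I_n => p.1 < p.2)%N) /=.
rewrite [X in _ + X](bigID (fun p : 'I_n * 'I_n => p.1 == p.2)) /=.
rewrite [X in _ + (X + _)]big1 ?add0r; last first.
  by move=> [i j] /= /andP[_ /eqP->]; rewrite bracketxx tens0r.
rewrite [X in _ + X](reindex_inj (h := fun p : 'I_n * 'I_n => (p.2, p.1))) /=; last first.
  by move=> [i j] [i' j'] [-> ->].
rewrite [X in _ + X](eq_big (fun p : 'I_n * 'I_n => p.1 < p.2)%N (fun p => - t p)) //.
- by rewrite sumrN subrr.
- by move=> [i j] /=; rewrite -leqNgt andbC eq_sym ltn_neqAle.
- by move=> p _; rewrite -tC.
Qed.

Lemma ext_bracket_jacobi u v w :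
  ext_bracket u (ext_bracket v w) + ext_bracket v (ext_bracket w u)
    + ext_bracket w (ext_bracket u v) = 0.
Proof.
pose J x y z := ext_bracket x (ext_bracket y z).
rewrite -/(J u v w) -/(J v w u) -/(J w u v).
have JD1 x x' y z : J (x + x') y z = J x y z + J x' y z by exact: linearDl.
have JD2 x y y' z : J x (y + y') z = J x y z + J x y' z.
  by rewrite /J linearDl linearDr.
have JD3 x y z z' : J x y (z + z') = J x y z + J x y z'.
  by rewrite /J !linearDr.
have sumD (a b c a' b' c' : LG) : a + b + c = 0 -> a' + b' + c' = 0 ->
    (a + a') + (b + b') + (c + c') = 0.
  by move=> e e'; rewrite (addrACA a a') (addrACA (a + b)) e e' addr0.
elim/tens_ind: u => [u u' | a x]; first by rewrite JD1 JD2 JD3; apply: sumD.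
elim/tens_ind: v => [v v' | b y]; first by rewrite JD1 JD2 JD3; apply: sumD.
elim/tens_ind: w => [w w' | c z]; first by rewrite JD1 JD2 JD3; apply: sumD.
rewrite /J !ext_bracket_tens (mulrA b) [b * c * a]mulrC.
have -> : c * (a * b) = a * (b * c) by rewrite mulrC mulrA.
by rewrite -!tensDr bracket_jacobi tens0r.
Qed.

HB.instance Definition _ := Vector_isLieAlgebra.Build L LG
  ext_bracket_linearl ext_bracket_linearr ext_bracketxx ext_bracket_jacobi.

Lemma bracket_tens a b x y :
  [Lie tens a x, tens b y] = tens (a * b) [Lie x, y].
Proof. exact: ext_bracket_tens. Qed.

(* For a subspace V of g, the image of L (x)_K V in L (x)_K g. *)
Definition ext_subspace (V : set g) : set LG :=
  [set u | exists2 s : seq (L * g),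
     (forall p, p \in s -> V p.2) & u = \sum_(p <- s) tens p.1 p.2].

End ScalarExtension.

Arguments tens {K L} f {g} a x.
Arguments ext_subspace {K L} f {g} V _.

(* Main.v *)
Require Import Defs.
From HB Require Import structures.
From mathcomp Require Import all_boot all_order all_algebra.
From mathcomp Require Import boolp classical_sets.
From mathcomp Require Import ring.

(* Let V = cni^+(g).  If D is a diagonalizable derivation with eigenvalues in N
   and F is a derivation with [D, F] = iF, i <> 0, then D + F is conjugate to D
   by an exponential, hence kills V, and so does F; decomposing a derivation
   under ad D, it follows that V is stable under all derivations.

   Suppose now that a derivation D of L (x) g, diagonalizable with eigenvalues
   in N, does not vanish on L (x) V; then tr(D | L (x) V) <> 0.  Write
   D = sum_j a_j S_j with S_j derivations of g and let S = sum_j t_j S_j be the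
   generic derivation over the rational function field K(t).  Let E act on the
   p-primary component of S, p an irreducible factor of its characteristic
   polynomial, by the average of the roots of p.  This is a derivation, since
   averages (normalised traces to K(t)) are additive.  By Gauss's lemma the
   averages specialise at t = a, and there they become averages of eigenvalues of
   D, so nonnegative rationals, not all zero on V because tr(D | L (x) V) <> 0.
   Up to a factor n!, acting by these specialised values gives a derivation over
   K(t) with eigenvalues in N that does not vanish on V.  Specialising t to a
   point of the infinite field K yields such a derivation of g, contradicting
   the definition of V. *)

Set Implicit Arguments.
Unset Strict Implicit.
Unset Printing Implicit Defensive.

Import GRing.Theory.
Local Open Scope ring_scope.

(** * Polynomials evaluated at square matrices of any size *)

(* [horner_mx] is only available in dimension [n.+1]. *)
HB.lock Definition mxeval (K : fieldType) n (A : 'M[K]_n) (p : {poly K}) : 'M[K]_n :=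
  \sum_(i < size p) p`_i *: A ^+ i.

Section MatrixEvaluation.
Variables (K : fieldType).
Implicit Types p q h : {poly K}.

Lemma mxevalE n (A : 'M[K]_n.+1) p : mxeval A p = horner_mx A p.
Proof.
rewrite unlock -[in RHS](coefK p) poly_def rmorph_sum /=; apply: eq_bigr => i _.
by rewrite linearZ rmorphXn /= horner_mx_X.
Qed.

Lemma mxevalD n (A : 'M[K]_n) p q : mxeval A (p + q) = mxeval A p + mxeval A q.
Proof.
case: n A => [|n] A; first by rewrite !thinmx0.
by rewrite !mxevalE rmorphD.
Qed.

Lemma mxevalN n (A : 'M[K]_n) p : mxeval A (- p) = - mxeval A p.
Proof.
case: n A => [|n] A; first by rewrite !thinmx0.
by rewrite !mxevalE rmorphN.
Qed.

Lemma mxevalB n (A : 'M[K]_n) p q : mxeval A (p - q) = mxeval A p - mxeval A q.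
Proof. by rewrite mxevalD mxevalN. Qed.

Lemma mxevalM n (A : 'M[K]_n) p q :
  mxeval A (p * q) = mxeval A p *m mxeval A q.
Proof.
case: n A => [|n] A; first by rewrite !thinmx0.
by rewrite !mxevalE rmorphM.
Qed.

Lemma mxevalC n (A : 'M[K]_n) c : mxeval A c%:P = c%:M.
Proof.
case: n A => [|n] A; first by rewrite !thinmx0.
by rewrite mxevalE horner_mx_C.
Qed.

Lemma mxeval0 n (A : 'M[K]_n) : mxeval A 0 = 0.
Proof. by rewrite -polyC0 mxevalC raddf0. Qed.

Lemma mxeval1 n (A : 'M[K]_n) : mxeval A 1 = 1%:M.
Proof. exact: mxevalC. Qed.

Lemma mxevalX n (A : 'M[K]_n) : mxeval A 'X = A.
Proof.
case: n A => [|n] A; first by rewrite !thinmx0.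
by rewrite mxevalE horner_mx_X.
Qed.

Lemma mxeval_sum n (A : 'M[K]_n) (I : Type) (r : seq I) (P : pred I)
    (F : I -> {poly K}) :
  mxeval A (\sum_(i <- r | P i) F i) = \sum_(i <- r | P i) mxeval A (F i).
Proof. exact: (big_morph _ (mxevalD A) (mxeval0 A)). Qed.

Lemma mxeval_comm n (A : 'M[K]_n) p q :
  mxeval A p *m mxeval A q = mxeval A q *m mxeval A p.
Proof. by rewrite -!mxevalM mulrC. Qed.

Lemma mxeval_commX n (A : 'M[K]_n) p : mxeval A p *m A = A *m mxeval A p.
Proof. by rewrite -{2 3}(mxevalX A) mxeval_comm. Qed.

(** Allowing a rectangular [F] covers conjugation, restriction to a stable row space and maps into a
    space of matrices at once. *)
Lemma mxeval_intertwine m n (A : 'M[K]_m) (B : 'M[K]_n) (F : 'M[K]_(m, n)) p :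
  A *m F = F *m B -> mxeval A p *m F = F *m mxeval B p.
Proof.
move=> AF; elim/poly_ind: p => [|p c IH].
  by rewrite !mxeval0 mul0mx mulmx0.
rewrite !mxevalD !mxevalM !mxevalC !mxevalX mulmxDl mulmxDr.
by rewrite -mulmxA AF !mulmxA IH scalar_mxC.
Qed.

Lemma dvdp_mxeval0 n (A : 'M[K]_n) p q :
  p %| q -> mxeval A p = 0 -> mxeval A q = 0.
Proof. by move=> /dvdpP [r ->] pA; rewrite mxevalM pA mulmx0. Qed.

Lemma mxeval_partition n (A : 'M[K]_n) h (I : Type) (r : seq I) (F : I -> {poly K}) :
  mxeval A h = 0 -> h %| \sum_(i <- r) F i - 1 ->
  \sum_(i <- r) mxeval A (F i) = 1%:M.
Proof.
move=> hA sum1; apply/eqP; rewrite -subr_eq0 -(mxeval1 A) -mxeval_sum -mxevalB.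
by rewrite (dvdp_mxeval0 sum1).
Qed.

Lemma mxeval_XsubC_eigen n (A : 'M[K]_n) h a p : mxeval A h = 0 ->
  h %| ('X - a%:P) * p -> A *m mxeval A p = a *: mxeval A p.
Proof.
move=> hA hp; apply/eqP; rewrite -subr_eq0 -mul_scalar_mx -mulmxBl.
by rewrite -{1}(mxevalX A) -(mxevalC A) -mxevalB -mxevalM (dvdp_mxeval0 hp).
Qed.

Lemma mxeval_char_poly n (A : 'M[K]_n) : mxeval A (char_poly A) = 0.
Proof.
case: n A => [|n] A; first by rewrite !thinmx0.
by rewrite mxevalE Cayley_Hamilton.
Qed.

(** [X - A] divides [h(X) - h(A)] among polynomial matrices; when [h(A) = 0], the determinant of
    what remains is [h ^+ n]. *)
Lemma char_poly_dvd_exp n (A : 'M[K]_n) h :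
  mxeval A h = 0 -> char_poly A %| h ^+ n.
Proof.
move=> hA.
have [Q defQ] : exists Q : 'M[{poly K}]_n,
    h%:M - map_mx polyC (mxeval A h) = char_poly_mx A *m Q.
  elim/poly_ind: {hA} h => [|p c [Q IH]].
    by exists 0; rewrite mxeval0 mulmx0 map_mx0 raddf0 subrr.
  (* From [p X - p(A) A = (X - A) p + A (p - p(A))], where [A] commutes with [X - A]. *)
  exists (p%:M + map_mx polyC A *m Q).
  rewrite mulmxDr mulmxA.
  have -> : char_poly_mx A *m map_mx polyC A = map_mx polyC A *m char_poly_mx A.
    by rewrite /char_poly_mx mulmxBl mulmxBr scalar_mxC.
  rewrite -mulmxA -IH mulmxBr /char_poly_mx mulmxBl -addrA addKr.
  rewrite mxevalD mxevalM mxevalX mxevalC mxeval_commX.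
  rewrite map_mxD /= map_mxM /= map_scalar_mx /= raddfD /= opprD addrACA subrr.
  by rewrite addr0 mulrC scalar_mxM.
move: defQ; rewrite hA map_mx0 subr0 => /(congr1 determinant).
by rewrite det_scalar det_mulmx => ->; apply: dvdp_mulr.
Qed.

End MatrixEvaluation.

(** * Sum of the roots of a monic polynomial *)

Section PolyTrace.
Variable (K : fieldType).
Implicit Types p q : {poly K}.

(* For monic [p], the sum of the roots; the factor ['X] gives 0 at [p = 1]. *)
Definition polytr p : K := - ('X * p)`_(size p).-1.

(** With [p = 'X^d + r] and [q = 'X^e + s], where [r] and [s] have lower degree, the coefficient of
    degree [d + e - 1] in the product receives nothing from [r * s]. *)
Lemma polytrM p q : p \is monic -> q \is monic ->
  polytr (p * q) = polytr p + polytr q.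
Proof.
have split p' : p' \is monic -> exists2 r, p' = 'X ^+ (size p').-1 + r
    & (size r <= (size p').-1)%N /\ polytr p' = - ('X * r)`_(size p').-1.
  move=> mp; exists (p' - 'X ^+ (size p').-1); first by rewrite addrC subrK.
  have sp : (0 < size p')%N by rewrite size_poly_gt0 monic_neq0.
  split; last first.
    by rewrite /polytr mulrBr coefB -exprS coefXn ltn_eqF ?subr0.
  apply/leq_sizeP => j hj; rewrite coefB coefXn.
  move: hj; rewrite leq_eqVlt => /orP[/eqP <-|hj].
    by rewrite eqxx -/(lead_coef p') (monicP mp) subrr.
  rewrite (gtn_eqF hj) subr0 nth_default //.
  by rewrite -(prednK sp).
move=> mp mq; have [r defp [sr tp]] := split p mp; have [s defq [ss tq]] := split q mq.
have sp : (0 < size p)%N by rewrite size_poly_gt0 monic_neq0.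
have sq : (0 < size q)%N by rewrite size_poly_gt0 monic_neq0.
rewrite tp tq /polytr size_monicM ?monic_neq0 //.
set d := (size p).-1 in defp sr tp *; set e := (size q).-1 in defq ss tq *.
have -> : (size p + size q).-2 = (d + e)%N.
  by rewrite /d /e; case: (size p) sp => // a _; case: (size q) sq => // b _; rewrite addnS.
have -> : 'X * (p * q) = 'X ^+ (d + e).+1 + ('X * r) * 'X^e + ('X * s) * 'X^d
   + 'X * (r * s).
  rewrite defp defq exprS exprD !mulrDl !mulrDr !mulrA -!addrA; congr (_ + _).
  by rewrite addrCA -(mulrA _ s) (mulrC s) !mulrA.
rewrite !coefD coefXn ltn_eqF // add0r !coefMXn.
rewrite !ltnNge leq_addl leq_addr /= addnK addKn.
suff -> : ('X * (r * s))`_(d + e) = 0 by rewrite addr0 opprD.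
rewrite coefXM; case: eqP => // /eqP; rewrite -lt0n => de.
rewrite nth_default //.
have [->|r0] := eqVneq r 0; first by rewrite mul0r size_poly0.
have [->|s0] := eqVneq s 0; first by rewrite mulr0 size_poly0.
by rewrite size_mul // -!subn1 leq_sub2r // leq_add.
Qed.

Lemma polytr1 : polytr 1 = 0.
Proof. by rewrite /polytr mulr1 size_poly1 coefX oppr0. Qed.

Lemma polytrX p n : p \is monic -> polytr (p ^+ n) = polytr p *+ n.
Proof.
move=> mp; elim: n => [|n IH]; first by rewrite polytr1.
by rewrite exprS polytrM ?monic_exp // IH mulrS.
Qed.

Lemma polytr_XsubC a : polytr ('X - a%:P) = a.
Proof.
by rewrite /polytr size_XsubC /= mulrBr coefB -expr2 coefXn coefMC coefX mul1r sub0r opprK.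
Qed.

Lemma polytr_prod_XsubC (s : seq K) :
  polytr (\prod_(a <- s) ('X - a%:P)) = \sum_(a <- s) a.
Proof.
elim: s => [|a s IH]; first by rewrite !big_nil polytr1.
by rewrite !big_cons polytrM ?monicXsubC ?monic_prod_XsubC // polytr_XsubC IH.
Qed.

Lemma polytr_char_poly n (A : 'M[K]_n) : polytr (char_poly A) = \tr A.
Proof.
rewrite /polytr size_char_poly coefXM /=.
case: n A => [|n] A /=; first by rewrite oppr0 /mxtrace big_ord0.
by rewrite char_poly_trace // opprK.
Qed.

Lemma irredp_neq0 p : irreducible_poly p -> p != 0.
Proof. by case=> sp _; rewrite -size_poly_gt0 ltnW. Qed.

Lemma irredp_coprime p q : irreducible_poly p -> ~~ (p %| q) -> coprimep p q.
Proof.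
move=> [sp irr] npq; rewrite /coprimep; apply: contraNT npq => sg.
by rewrite -(eqp_dvdl _ (irr _ sg (dvdp_gcdl _ _))) dvdp_gcdr.
Qed.

Lemma dvdp_irredX p f n : irreducible_poly p -> p \is monic -> f \is monic ->
  f %| p ^+ n -> exists k, f = p ^+ k.
Proof.
move=> irr mp; elim: n f => [|n IH] f mf.
  rewrite expr0 => fp; exists 0; rewrite expr0.
  by apply/eqP; rewrite -eqp_monic ?monic1 // -size_poly_eq1 -dvdp1.
move=> fp; have [pf|npf] := boolP (p %| f); last first.
  exists 0; apply/eqP; rewrite expr0 -eqp_monic ?monic1 // -size_poly_eq1.
  rewrite -coprimepp; apply: coprimep_dvdl fp _.
  by rewrite coprimep_expr // coprimep_sym irredp_coprime.
have p0 := irredp_neq0 irr.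
have [g defg] : exists g, f = g * p by apply/dvdpP.
have mg : g \is monic by rewrite -(monicMr _ mp) -defg.
have [k defk] : exists k, g = p ^+ k.
  by apply: IH mg _; move: fp; rewrite defg exprSr dvdp_mul2r.
by exists k.+1; rewrite defg defk exprSr.
Qed.

(** The characteristic polynomial divides a power of [p], hence is some [p ^+ k] with
    [k * deg p = n], and the trace is [k] times the root sum of [p]. *)
Lemma mxtrace_primary p m n (B : 'M[K]_n) : irreducible_poly p ->
  p \is monic -> mxeval B (p ^+ m) = 0 ->
  \tr B *+ (size p).-1 = polytr p *+ n.
Proof.
move=> irr mp /char_poly_dvd_exp; rewrite -exprM.
case/(dvdp_irredX irr mp (char_poly_monic B)) => k defB.
rewrite -polytr_char_poly defB polytrX // -mulrnA; congr (_ *+ _).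
have := size_char_poly B; rewrite defB.
by move/(congr1 predn); rewrite size_exp /= mulnC.
Qed.

End PolyTrace.

(** * Primary decomposition *)

Section PrimaryDecomposition.
Variable K : fieldType.
Implicit Types p q h : {poly K}.

Lemma irredp_factor h : (1 < size h)%N ->
  exists p, [/\ irreducible_poly p, p \is monic & p %| h].
Proof.
have [m] := ubnP (size h); elim: m h => // m IH h hm sh.
have [irr|nirr] := pselect (irreducible_poly h).
  have h0 : lead_coef h != 0 by rewrite lead_coef_eq0 -size_poly_gt0 ltnW.
  have eh : (lead_coef h)^-1 *: h %= h by rewrite eqp_scale ?invr_neq0.
  exists ((lead_coef h)^-1 *: h); split; last by rewrite (eqp_dvdl _ eh).
  - split; first by rewrite (eqp_size eh).
    move=> q sq; rewrite (eqp_dvdr _ eh) => /irr.2 => /(_ sq) eqh.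
    by rewrite (eqp_trans eqh) // eqp_sym.
  - by rewrite monicE lead_coefZ mulVf.
have [q [sq qh nqh]] : exists q, [/\ size q != 1, q %| h & ~~ (q %= h)].
  apply: contrapT => no; apply: nirr; split=> // q sq qh.
  by apply/negPn/negP => nq; apply: no; exists q.
have h0 : h != 0 by rewrite -size_poly_gt0 ltnW.
have q0 : q != 0 by apply: contraTneq qh => ->; rewrite dvd0p.
have [||p [ip mp pq]] := IH q.
- rewrite -ltnS; apply: leq_trans hm; rewrite ltnS.
  by rewrite ltn_neqAle dvdp_leq // andbT dvdp_size_eqp //.
- by rewrite ltn_neqAle eq_sym sq size_poly_gt0.
by exists p; split=> //; apply: dvdp_trans pq qh.
Qed.

Lemma irredp_coprime_part h p : h != 0 -> irreducible_poly p ->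
  exists k r, h = p ^+ k * r /\ coprimep p r.
Proof.
move=> + irr; have [m] := ubnP (size h); elim: m h => // m IH h hm h0.
have [/dvdpP [g defh]|nph] := boolP (p %| h); last first.
  by exists 0, h; rewrite mul1r irredp_coprime.
have g0 : g != 0 by apply: contra_neq h0 => g0; rewrite defh g0 mul0r.
have [|k [r [defg cpr]]] := IH g _ g0.
  move: hm; rewrite defh size_mul ?(irredp_neq0 irr) //.
  case: irr => sp _; case: (size p) sp => // -[|a] // _.
  by rewrite !addnS /= ltnS; apply: leq_trans; rewrite ltnS leq_addr.
by exists k.+1, r; rewrite defh defg mulrC exprS mulrA.
Qed.

(** Evaluated at a matrix killed by [h], the second components become the projectors onto the
    primary components. One irreducible factor is split off at a time. *)
Lemma primary_idempotents h : h != 0 -> exists s : seq ({poly K} * {poly K}),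
  [/\ forall z, z \in s -> [/\ irreducible_poly z.1, z.1 \is monic, z.1 %| h
                             & exists k, h %| z.1 ^+ k * z.2]
    & h %| \sum_(z <- s) z.2 - 1].
Proof.
have [m] := ubnP (size h); elim: m h => // m IH h hm h0.
have [sh|] := ltnP 1 (size h); last first.
  move=> sh; exists [::]; split=> //; rewrite big_nil sub0r dvdpNr dvdp1.
  by rewrite eqn_leq sh size_poly_gt0.
have [p [ip mp ph]] := irredp_factor sh.
have [k [r [defh cpr]]] := irredp_coprime_part h0 ip.
have k0 : (0 < k)%N.
  rewrite lt0n; apply: contraTneq ph => k0; rewrite defh k0 mul1r.
  apply/negP => pr; case: ip; rewrite -(eqp_size (dvdp_gcd_idl pr)).
  by move: cpr; rewrite /coprimep => /eqP ->.
have r0 : r != 0 by apply: contra_neq h0 => r0; rewrite defh r0 mulr0.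
have spk : (1 < size (p ^+ k))%N.
  rewrite -subn_gt0 subn1 size_exp muln_gt0 k0 andbT -subn1 subn_gt0.
  by case: ip.
have [|s [sP sumS]] := IH r _ r0.
  move: hm; rewrite defh size_mul ?expf_neq0 ?(irredp_neq0 ip) //.
  case: (size (p ^+ k)) spk => // -[|a] // _.
  by rewrite !addSn /= ltnS; apply: leq_trans; rewrite ltnS leq_addl.
have /Bezout_eq1_coprimepP [[u v] /= uv] := coprimep_expl k cpr.
(* As [u p^k + v r = 1], the term [v r] is 1 modulo [p^k] and 0 modulo [r]; the factor [u p^k]
   behaves the other way round and lifts the projectors of [r]. *)
exists ((p, v * r) :: [seq (z.1, z.2 * (u * p ^+ k)) | z <- s]); split.
  move=> z; rewrite inE => /orP[/eqP -> /=|/mapP[y ys -> /=]].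
    by split=> //; exists k; rewrite defh dvdp_mul // dvdp_mull.
  have [iy my yr [j rj]] := sP y ys; split=> //.
    by rewrite defh dvdp_mull.
  exists j; rewrite defh.
  have -> : y.1 ^+ j * (y.2 * (u * p ^+ k)) = p ^+ k * (y.1 ^+ j * y.2) * u by ring.
  by rewrite dvdp_mulr // dvdp_mul.
rewrite big_cons big_map /= -mulr_suml.
set S := \sum_(z <- s) z.2 in sumS *.
have -> : v * r + S * (u * p ^+ k) - 1 = p ^+ k * (S - 1) * u.
  by rewrite -[in LHS]uv; ring.
by rewrite defh dvdp_mulr // dvdp_mul.
Qed.

End PrimaryDecomposition.

(** * Derivations of an algebra and their replicas *)

HB.lock Definition mxad (K : fieldType) n (c : 'I_n -> 'M[K]_n) (u : 'rV[K]_n) : 'M[K]_n :=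
  \sum_k u 0 k *: c k.

Section Replica.
Variables (K : fieldType) (K0 : has_pchar0 K).
Implicit Types p q h : {poly K}.

Lemma natr_neq0 k : (0 < k)%N -> k%:R != 0 :> K.
Proof. by move=> k0; have /pcharf0P -> := K0; rewrite -lt0n. Qed.

Definition avgroot p : K := polytr p / (size p).-1%:R.

Lemma mxtrace_primary_avg p m n (B : 'M[K]_n) : irreducible_poly p ->
  p \is monic -> mxeval B (p ^+ m) = 0 -> \tr B = n%:R * avgroot p.
Proof.
move=> ip mp pB; have := mxtrace_primary ip mp pB.
have d0 : (size p).-1%:R != 0 :> K.
  by apply: natr_neq0; case: ip; case: (size p) => [|[]].
by move=> e; apply: (mulIf d0); rewrite mulr_natr e /avgroot mulrA divfK // mulr_natl.
Qed.

(* Both sides are the normalised traces of [r] and [l], [r - l] on the common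
   stable subspace annihilated by the three primary polynomials. *)
Lemma avgrootD m (l r : 'M[K]_m) (x : 'rV[K]_m) p q s a b c :
    l *m r = r *m l -> x != 0 ->
    [/\ irreducible_poly p, irreducible_poly q & irreducible_poly s] ->
    [/\ p \is monic, q \is monic & s \is monic] ->
    x *m mxeval l (q ^+ b) = 0 -> x *m mxeval r (s ^+ c) = 0 ->
    x *m mxeval (r - l) (p ^+ a) = 0 ->
  avgroot s = avgroot q + avgroot p.
Proof.
move=> lr x0 [ip iq is_] [mp mq ms] xq xs xp.
pose U := (kermx (mxeval l (q ^+ b)) :&: kermx (mxeval r (s ^+ c))
            :&: kermx (mxeval (r - l) (p ^+ a)))%MS.
have xU : (x <= U)%MS by rewrite !sub_capmx !(sameP sub_kermxP eqP) xq xs xp !eqxx.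
have stab (y z : 'M[K]_m) (g : {poly K}) : y *m z = z *m y ->
    stablemx (kermx (mxeval z g)) y.
  move=> yz; apply/sub_kermxP.
  rewrite -mulmxA -(mxeval_intertwine (B := z) _ (esym yz)).
  by rewrite mulmxA mulmx_ker mul0mx.
have cl : l *m (r - l) = (r - l) *m l by rewrite mulmxBl mulmxBr lr.
have cr : r *m (r - l) = (r - l) *m r by rewrite mulmxBl mulmxBr lr.
have cap (V W : 'M[K]_m) y : stablemx V y -> stablemx W y -> stablemx (V :&: W)%MS y.
  move=> Vy Wy; rewrite sub_capmx (submx_trans _ Vy) ?submxMr ?capmxSl //.
  by rewrite (submx_trans _ Wy) ?submxMr ?capmxSr.
have Ul : stablemx U l.
  exact: (cap _ _ _ (cap _ _ _ (stab _ _ _ erefl) (stab _ _ _ lr)) (stab _ _ _ cl)).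
have Ur : stablemx U r.
  exact: (cap _ _ _ (cap _ _ _ (stab _ _ _ (esym lr)) (stab _ _ _ erefl)) (stab _ _ _ cr)).
(* In a basis of [U], each of [l], [r], [r - l] becomes a matrix killed by a power of one
   irreducible polynomial, so its trace is [\rank U] times an average root. *)
pose B := row_base U.
have fB : row_free B := row_base_free U.
have restr y : stablemx U y -> exists y', y' *m B = B *m y.
  move=> Uy; have : (B *m y <= B)%MS.
    by rewrite !eq_row_base (submx_trans _ Uy) // submxMr ?eq_row_base.
  by case/submxP => y' ->; exists y'.
have [l' l'B] := restr l Ul; have [r' r'B] := restr r Ur.
have kill y y' g : y' *m B = B *m y -> (U <= kermx (mxeval y g))%MS ->
    mxeval y' g = 0.
  move=> yB Uk; apply: (row_free_inj fB); rewrite mul0mx.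
  rewrite (mxeval_intertwine _ yB); apply/sub_kermxP.
  by rewrite eq_row_base.
have eq : \tr l' = (\rank U)%:R * avgroot q.
  apply: (mxtrace_primary_avg (m := b)) => //; apply: kill l'B _.
  by rewrite (submx_trans (capmxSl _ _)) ?capmxSl.
have es : \tr r' = (\rank U)%:R * avgroot s.
  apply: (mxtrace_primary_avg (m := c)) => //; apply: kill r'B _.
  by rewrite (submx_trans (capmxSl _ _)) ?capmxSr.
have ep : \tr (r' - l') = (\rank U)%:R * avgroot p.
  apply: (mxtrace_primary_avg (m := a)) => //; apply: (kill (r - l)).
    by rewrite mulmxBl mulmxBr l'B r'B.
  by rewrite capmxSr.
have k0 : (\rank U)%:R != 0 :> K.
  apply: natr_neq0; rewrite lt0n mxrank_eq0; apply: contraNneq x0 => U0.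
  by move: xU; rewrite U0 submx0.
by apply: (mulfI k0); rewrite mulrDr -es -eq -ep -raddfD addrC subrK.
Qed.

Variable n : nat.
Implicit Types (A E X : 'M[K]_n) (u v : 'rV[K]_n).

Lemma mxvec_mxeval_mulmx A X p :
  mxvec X *m mxeval (lin_mulmx A) p = mxvec (mxeval A p *m X).
Proof.
elim/poly_ind: p X => [|p k IH] X; first by rewrite !mxeval0 mulmx0 mul0mx linear0.
rewrite !mxevalD !mxevalM !mxevalX !mxevalC mulmxDr mulmxDl linearD /=.
rewrite mulmxA IH mul_vec_lin /= mxeval_commX mulmxA.
by rewrite mul_mx_scalar mul_scalar_mx linearZ.
Qed.

Lemma mxvec_mxeval_mulmxr A X p :
  mxvec X *m mxeval (lin_mulmxr A) p = mxvec (X *m mxeval A p).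
Proof.
elim/poly_ind: p X => [|p k IH] X; first by rewrite !mxeval0 !mulmx0 linear0.
rewrite !mxevalD !mxevalM !mxevalX !mxevalC !mulmxDr linearD /=.
by rewrite mulmxA IH mul_vec_lin /= mulmxA !mul_mx_scalar linearZ.
Qed.

Lemma lin_mulmx_comm A B : lin_mulmx A *m lin_mulmxr B = lin_mulmxr B *m lin_mulmx A
  :> 'M[K]_(n * n).
Proof.
apply/row_matrixP => i; rewrite !rowE -(vec_mxK (delta_mx 0 i)) !mulmxA.
by rewrite !mul_vec_lin /= mulmxA.
Qed.

Variable c : 'I_n -> 'M[K]_n.

Local Notation mxad := (mxad c).

Lemma mxadE u : mxad u = \sum_k u 0 k *: c k.
Proof. by rewrite unlock. Qed.

Lemma mxadD u v : mxad (u + v) = mxad u + mxad v.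
Proof. by rewrite !mxadE -big_split; apply: eq_bigr => k _; rewrite mxE scalerDl. Qed.

Lemma mxadZ a u : mxad (a *: u) = a *: mxad u.
Proof. by rewrite !mxadE scaler_sumr; apply: eq_bigr => k _; rewrite mxE scalerA. Qed.

Lemma mxad0 : mxad 0 = 0.
Proof. by rewrite mxadE; apply: big1 => k _; rewrite mxE scale0r. Qed.

Lemma mxad_sum (I : Type) (r : seq I) (F : I -> 'rV[K]_n) :
  mxad (\sum_(i <- r) F i) = \sum_(i <- r) mxad (F i).
Proof. exact: (big_morph _ mxadD mxad0). Qed.

(* The algebra on row vectors whose product [u . v] is [v *m mxad u];
   [mxder A] says that [A], acting on the right, is a derivation. *)
Definition mxder A := forall i, c i *m A = A *m c i + \sum_k A i k *: c k.

Lemma mxderP A : mxder A <-> forall u, mxad u *m A = A *m mxad u + mxad (u *m A).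
Proof.
have E u : mxad (u *m A) = \sum_i u 0 i *: \sum_k A i k *: c k.
  rewrite mulmx_sum_row mxad_sum; apply: eq_bigr => i _.
  by rewrite mxadZ mxadE; congr (_ *: _); apply: eq_bigr => k _; rewrite mxE.
split=> [dA u|dA i].
  rewrite E !mxadE mulmx_suml mulmx_sumr -big_split; apply: eq_bigr => i _ /=.
  by rewrite -scalemxAl dA -scalemxAr scalerDr.
have ci : mxad (delta_mx 0 i) = c i.
  rewrite mxadE (bigD1 i) //= big1 ?addr0 ?mxE ?eqxx ?scale1r // => k ki.
  by rewrite mxE (negPf ki) scale0r.
have := dA (delta_mx 0 i); rewrite ci => ->; congr (_ + _).
by rewrite -rowE mxadE; apply: eq_bigr => k _; rewrite mxE.
Qed.

(* The product of the [p]- and [q]-primary components of a derivation has a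
   nonzero [s]-primary component only if average roots add up. *)
Lemma mxder_component A p q s (a b d : nat) (P Q S : {poly K}) v :
    mxder A ->
    [/\ irreducible_poly p, irreducible_poly q & irreducible_poly s] ->
    [/\ p \is monic, q \is monic & s \is monic] ->
    mxeval A (p ^+ a * P) = 0 -> mxeval A (q ^+ b * Q) = 0 ->
    mxeval A (s ^+ d * S) = 0 ->
    mxeval A Q *m mxad (v *m mxeval A P) *m mxeval A S != 0 ->
  avgroot s = avgroot q + avgroot p.
Proof.
move=> dA irr mon pP qQ sS X0.
(* [F] maps [u] to [Q(A) (mxad u) S(A)]. The derivation identity makes it intertwine [A] with right
   minus left multiplication by [A], the setting of [avgrootD]. *)
pose F : 'M[K]_(n, n * n) :=
  \matrix_i mxvec (mxeval A Q *m c i *m mxeval A S).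
have FE u : u *m F = mxvec (mxeval A Q *m mxad u *m mxeval A S).
  rewrite mulmx_sum_row mxadE mulmx_sumr mulmx_suml linear_sum; apply: eq_bigr => i _ /=.
  by rewrite rowK -scalemxAr -scalemxAl linearZ.
apply: (avgrootD (l := lin_mulmx A) (r := lin_mulmxr A)
  (x := v *m mxeval A P *m F) (a := a) (b := b) (c := d)) => //.
- exact: lin_mulmx_comm.
- by rewrite FE; apply: contraNneq X0 => /(congr1 vec_mx); rewrite mxvecK linear0 => ->.
- by rewrite FE mxvec_mxeval_mulmx !mulmxA -mxevalM qQ !mul0mx linear0.
- by rewrite FE mxvec_mxeval_mulmxr -mulmxA -mxevalM mulrC sS mulmx0 linear0.
rewrite -mulmxA -(mxeval_intertwine (A := A)).
  by rewrite mulmxA -(mulmxA v) -mxevalM mulrC pP mulmx0 mul0mx.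
apply/row_matrixP => i; rewrite !row_mul rowE FE rowK mulmxBr.
rewrite !mul_vec_lin /= -linearB /=; congr mxvec.
rewrite -!mulmxA (mxeval_commX A S) !mulmxA -(mulmxA _ (c i)) dA.
rewrite -(mxeval_commX A Q) mulmxDr mulmxDl !mulmxA addrAC subrr add0r.
by rewrite -rowE mxadE; congr (_ *m _ *m _); apply: eq_bigr => k _; rewrite mxE.
Qed.

(** [E] scales each primary component by the weight of its irreducible polynomial. Products of
    components land only where average roots add up, and there the weights add up too. *)
Lemma mxder_replica A h (s : seq ({poly K} * {poly K})) (th : {poly K} -> K) :
    mxder A -> mxeval A h = 0 ->
    (forall z, z \in s -> [/\ irreducible_poly z.1, z.1 \is monic, z.1 %| h
                           & exists k, h %| z.1 ^+ k * z.2]) ->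
    h %| \sum_(z <- s) z.2 - 1 ->
    (forall x y z, x \in s -> y \in s -> z \in s ->
       avgroot z.1 = avgroot x.1 + avgroot y.1 ->
       th z.1 = th x.1 + th y.1) ->
  let E := \sum_(z <- s) th z.1 *: mxeval A z.2 in
  mxder E /\ forall z, z \in s -> E *m mxeval A z.2 = th z.1 *: mxeval A z.2.
Proof.
move=> dA hA sP sum1 thD E.
have I1 : \sum_(z <- s) mxeval A z.2 = 1%:M.
  exact: mxeval_partition hA sum1.
have prim z : z \in s -> exists k, mxeval A (z.1 ^+ k * z.2) = 0.
  by case/sP => _ _ _ [k hk]; exists k; apply: dvdp_mxeval0 hk hA.
have orth x y : x \in s -> y \in s -> x.1 != y.1 ->
    mxeval A x.2 *m mxeval A y.2 = 0.
  move=> xs ys xy; have [k kx] := prim x xs; have [l ly] := prim y ys.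
  have [ix mx _ _] := sP x xs; have [iy my _ _] := sP y ys.
  have cxy : coprimep (x.1 ^+ k) (y.1 ^+ l).
    rewrite coprimep_expl // coprimep_expr // irredp_coprime //.
    apply: contra xy => xy; rewrite -eqp_monic //; apply: iy.2 => //.
    by rewrite gtn_eqF //; case: ix.
  have [[u v] /= uv] := Bezout_eq1_coprimepP _ _ cxy.
  rewrite -mxevalM -[X in mxeval A X]mul1r -uv mulrDl mxevalD.
  have -> : u * x.1 ^+ k * (x.2 * y.2) = (x.1 ^+ k * x.2) * (u * y.2) by ring.
  have -> : v * y.1 ^+ l * (x.2 * y.2) = (y.1 ^+ l * y.2) * (v * x.2) by ring.
  by rewrite !(mxevalM A (_ * _)) kx ly !mul0mx addr0.
have idE z : z \in s -> mxeval A z.2 *m E = th z.1 *: mxeval A z.2.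
  move=> zs; rewrite -[in RHS](mulmx1 (mxeval A z.2)) -I1 !mulmx_sumr scaler_sumr.
  rewrite !big_seq; apply: eq_bigr => y ys; rewrite -scalemxAr.
  by have [->|/(orth z y zs ys) ->] := eqVneq z.1 y.1; rewrite ?scaler0.
have idE' z : z \in s -> E *m mxeval A z.2 = th z.1 *: mxeval A z.2.
  move=> zs; rewrite -idE // mulmx_suml mulmx_sumr; apply: eq_bigr => y _.
  by rewrite -scalemxAl -scalemxAr mxeval_comm.
split=> //; apply/mxderP => u.
(* By linearity the first factor of the product may be taken in a single primary component. *)
clearbody E; suff comp v z : z \in s ->
    mxad (v *m mxeval A z.2) *m E = E *m mxad (v *m mxeval A z.2)
      + mxad (v *m mxeval A z.2 *m E).
  rewrite -(mulmx1 u) -I1 mulmx_sumr mulmx_suml !mxad_sum mulmx_suml mulmx_sumr.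
  by rewrite -big_split !big_seq; apply: eq_bigr => z zs; apply: comp.
move=> zs; rewrite -(mulmxA v) idE // -scalemxAr mxadZ.
set Y := mxad _.
have split2 (Z : 'M[K]_n) : Z = \sum_(x <- s) \sum_(y <- s) mxeval A x.2 *m Z *m mxeval A y.2.
  rewrite -[LHS]mul1mx -I1 mulmx_suml; apply: eq_bigr => x _.
  by rewrite -mulmx_sumr I1 mulmx1.
(* The identity is checked on each block cut out by two projectors; on a nonzero block
   [mxder_component] relates the average roots. *)
rewrite [LHS]split2 [RHS]split2 !big_seq; apply: eq_bigr => x xs.
rewrite !big_seq; apply: eq_bigr => y ys.
rewrite mulmxDr mulmxDl -!mulmxA idE' // (mulmxA _ E) idE //.
rewrite -!scalemxAr -!scalemxAl -!scalemxAr -scalerDl.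
have [->|N0] := eqVneq (mxeval A x.2 *m (Y *m mxeval A y.2)) 0; first by rewrite !scaler0.
congr (_ *: _).
have [[k kx] [l ly] [d dz]] := And3 (prim x xs) (prim y ys) (prim z zs).
have [[ix mx _ _] [iy my _ _] [iz mz _ _]] := And3 (sP x xs) (sP y ys) (sP z zs).
apply: thD => //; apply: (mxder_component (v := v)) dA _ _ dz kx ly _ => //.
by rewrite -/Y -mulmxA.
Qed.

End Replica.

(** * Places and Gauss's lemma *)

(* Places of [F] with values in [O], as graphs: the domain of [R] is a
   valuation ring and [R] is the reduction modulo its maximal ideal. *)
Record place (F O : fieldType) (R : F -> O -> Prop) : Prop := Place {
  place1 : R 1 1;
  placeB : forall x x' y y', R x y -> R x' y' -> R (x - x') (y - y');
  placeM : forall x x' y y', R x y -> R x' y' -> R (x * x') (y * y');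
  place0_eq : forall y, R 0 y -> y = 0;
  placeV : forall x, (exists y, R x y) \/ R x^-1 0 }.

Section PlaceTheory.
Variables (F O : fieldType) (R : F -> O -> Prop) (pl : place R).

Lemma place0 : R 0 0.
Proof. by rewrite -(subrr 1) -[X in R _ X](subrr 1); apply: placeB pl _ _ _ _ _ _; apply: place1. Qed.

Lemma placeN x y : R x y -> R (- x) (- y).
Proof. by move=> xy; rewrite -sub0r -[X in R _ X]sub0r; apply: placeB pl _ _ _ _ _ _; first apply: place0. Qed.

Lemma placeD x x' y y' : R x y -> R x' y' -> R (x + x') (y + y').
Proof. by move=> xy /placeN; rewrite -{2}[x']opprK -{2}[y']opprK; apply: placeB. Qed.

Lemma place_inj x y y' : R x y -> R x y' -> y = y'.
Proof.
move=> xy xy'; apply/eqP; rewrite -subr_eq0; apply/eqP/(place0_eq pl).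
by rewrite -(subrr x); apply: placeB pl _ _ _ _ _ _.
Qed.

Lemma place_neq0 x y : R x y -> y != 0 -> x != 0.
Proof. by move=> xy; apply: contra_neq => x0; apply: (place0_eq pl); rewrite -x0. Qed.

Lemma placeVr x y : R x y -> y != 0 -> R x^-1 y^-1.
Proof.
move=> xy y0; have x0 := place_neq0 xy y0.
case: (placeV pl x^-1) => [[z xz]|]; last first.
  by rewrite invrK => x_0; rewrite (place_inj xy x_0) eqxx in y0.
suff -> : y^-1 = z by [].
apply: (mulfI y0); rewrite divff //; apply: place_inj (place1 pl) _.
by rewrite -(divff x0); apply: placeM pl _ _ _ _ _ _.
Qed.

Lemma place_sum (I : Type) (r : seq I) (P : pred I) f g :
  (forall i, P i -> R (f i) (g i)) ->
  R (\sum_(i <- r | P i) f i) (\sum_(i <- r | P i) g i).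
Proof. by move=> fg; elim/big_ind2: _ => //; [apply: place0 | move=> *; apply: placeD]. Qed.

Lemma place_nat k : R k%:R k%:R.
Proof.
elim: k => [|k IH]; first exact: place0.
by rewrite -!natr1; apply: placeD => //; apply: place1.
Qed.

Lemma placeMn x y k : R x y -> R (x *+ k) (y *+ k).
Proof. by move=> xy; rewrite -[x *+ k]mulr_natr -[y *+ k]mulr_natr; apply: (placeM pl) => //; apply: place_nat. Qed.

Lemma place_char0 : has_pchar0 O -> has_pchar0 F.
Proof.
move=> /pcharf0P O0; apply/pcharf0P => k; apply/eqP/eqP => [k0|-> //].
by apply/eqP; rewrite -O0; apply/eqP/(place0_eq pl); rewrite -k0; apply: place_nat.
Qed.

Definition place_mx m n (A : 'M[F]_(m, n)) (B : 'M[O]_(m, n)) :=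
  forall i j, R (A i j) (B i j).

Lemma place_mulmx m n k (A : 'M_(m, n)) (B : 'M_(n, k)) A' B' :
  place_mx A A' -> place_mx B B' -> place_mx (A *m B) (A' *m B').
Proof. by move=> AA BB i j; rewrite !mxE; apply: place_sum => l _; apply: placeM. Qed.

Lemma place_mx_inj m n (A : 'M_(m, n)) B B' : place_mx A B -> place_mx A B' -> B = B'.
Proof. by move=> AB AB'; apply/matrixP => i j; apply: place_inj (AB i j) (AB' i j). Qed.

Lemma place_trace n (A : 'M_n) B : place_mx A B -> R (\tr A) (\tr B).
Proof. by move=> AB; apply: place_sum. Qed.

Definition place_poly (p : {poly F}) (q : {poly O}) := forall i, R p`_i q`_i.

Lemma place_polyM p q p' q' :
  place_poly p p' -> place_poly q q' -> place_poly (p * q) (p' * q').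
Proof. by move=> pp qq i; rewrite !coefM; apply: place_sum => j _; apply: (placeM pl) (pp j) (qq _). Qed.

Lemma place_poly_inj p q q' : place_poly p q -> place_poly p q' -> q = q'.
Proof. by move=> pq pq'; apply/polyP => i; apply: place_inj (pq i) (pq' i). Qed.

Lemma place_poly_sum (I : Type) (r : seq I) (P : pred I) f g :
  (forall i, P i -> place_poly (f i) (g i)) ->
  place_poly (\sum_(i <- r | P i) f i) (\sum_(i <- r | P i) g i).
Proof. by move=> fg j; rewrite !coef_sum; apply: place_sum => i Pi; apply: fg. Qed.

Lemma place_polyC x y : R x y -> place_poly x%:P y%:P.
Proof. by move=> xy i; rewrite !coefC; case: eqP => // _; apply: place0. Qed.

Lemma place_poly_prod (I : Type) (r : seq I) (P : pred I) f g :
  (forall i, P i -> place_poly (f i) (g i)) ->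
  place_poly (\prod_(i <- r | P i) f i) (\prod_(i <- r | P i) g i).
Proof.
move=> fg; apply: (big_ind2 place_poly) => [|*|//]; last exact: place_polyM.
exact/place_polyC/(place1 pl).
Qed.

Lemma place_polyB p q p' q' :
  place_poly p p' -> place_poly q q' -> place_poly (p - q) (p' - q').
Proof. by move=> pp qq i; rewrite !coefB; apply: (placeB pl) (pp i) (qq i). Qed.

Lemma place_polyX : place_poly 'X 'X.
Proof. by move=> i; rewrite !coefX; apply: place_nat. Qed.

Lemma place_char_poly n (A : 'M_n) B : place_mx A B -> place_poly (char_poly A) (char_poly B).
Proof.
move=> AB; apply: place_poly_sum => s _; apply: place_polyM.
  have sgn (K : fieldType) (b : bool) : (-1 : {poly K}) ^+ b = ((-1) ^+ b)%:P.
    by rewrite rmorphXn rmorphN1.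
  rewrite !sgn; apply: place_polyC.
  by case: (perm.odd_perm s); rewrite ?expr1 ?expr0; [apply: placeN|]; apply: place1 pl.
apply: place_poly_prod => i _; rewrite !mxE; apply: place_polyB; last exact: place_polyC.
by case: eqP => _; rewrite ?mulr1n ?mulr0n; [apply: place_polyX|apply/place_polyC/place0].
Qed.

Lemma place_polytr (p : {poly F}) (q : {poly O}) : size p = size q -> place_poly p q -> R (polytr p) (polytr q).
Proof.
move=> spq pq; rewrite /polytr spq; apply: placeN.
exact: place_polyM place_polyX pq _.
Qed.

(** Scaling by the inverse of an entry of least valuation puts the whole family in the valuation
    ring. *)
Lemma place_normalize (s : seq F) : has (predC1 0) s -> exists a,
  (forall x, x \in s -> exists y, R (a * x) y) /\ (exists2 x, x \in s & a * x = 1).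
Proof.
elim: s => // x s IH /=; have [/IH [a [aO [x1 x1s ax1]]] _|] := boolP (has (predC1 0) s).
  have [[y axy]|axV] := placeV pl (a * x).
    exists a; split; last by exists x1; rewrite // inE x1s orbT.
    by move=> z; rewrite inE => /predU1P[->|/aO//]; exists y.
  have [x0|x0] := eqVneq x 0.
    exists a; split; last by exists x1; rewrite // inE x1s orbT.
    by move=> z; rewrite inE => /predU1P[->|/aO//]; exists 0; rewrite x0 mulr0; apply: place0.
  (* Now [a * x] has a pole, so [x] has smaller valuation than the entries normalised before and
     takes over. *)
  exists x^-1; split; last by exists x; rewrite ?inE ?eqxx ?mulVf.
  move=> z; rewrite inE => /predU1P[->|/aO [y azy]].
    by exists 1; rewrite mulVf //; apply: place1.
  exists (0 * y); have a0 : a != 0.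
    by apply: contra_eq_neq ax1 => ->; rewrite mul0r eq_sym oner_eq0.
  suff -> : x^-1 * z = (a * x)^-1 * (a * z) by apply: placeM pl _ _ _ _ _ _.
  by rewrite invfM mulrA (mulrC _ x^-1) -(mulrA _ _ a) mulVf ?mulr1.
move=> /hasPn s0; rewrite orbF => x0; exists x^-1; split; last first.
  by exists x; rewrite ?inE ?eqxx ?mulVf.
move=> z; rewrite inE => /predU1P[->|/s0 /=].
  by exists 1; rewrite mulVf //; apply: place1.
by rewrite negbK => /eqP ->; exists 0; rewrite mulr0; apply: place0.
Qed.

Lemma place_monic_normalize (p : {poly F}) : p \is monic ->
  exists a b P, [/\ a != 0, R a b, P != 0 & place_poly (a *: p) P].
Proof.
move=> mp; have lp : 1 \in (p : seq F).
  have := monicP mp; rewrite /lead_coef => <-; apply: mem_nth.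
  by rewrite prednK ?size_poly_gt0 ?monic_neq0.
have [|a [aO [x xp ax]]] := @place_normalize p.
  by apply/hasP; exists 1; rewrite //= oner_eq0.
have a0 : a != 0.
  by apply: contra_eq_neq ax => ->; rewrite mul0r eq_sym oner_eq0.
have [b ab] := aO _ lp; rewrite mulr1 in ab.
have ex i : exists y, R (a * p`_i) y.
  have [hi|hi] := ltnP i (size p); first by apply/aO/mem_nth.
  by exists 0; rewrite nth_default // mulr0; apply: place0.
have [f fP] := choice ex.
have PP : place_poly (a *: p) (\poly_(i < size p) f i).
  move=> i; rewrite coefZ coef_poly; case: ifP => // /negbT; rewrite -leqNgt => hi.
  by rewrite nth_default // mulr0; apply: place0.
exists a, b, (\poly_(i < size p) f i); split=> //.
have /(nthP 0) [i hi xi] := xp.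
apply/eqP => /polyP /(_ i) P0; have := PP i; rewrite P0 coef0 coefZ xi ax => R10.
by have := place_inj R10 (place1 pl); apply/eqP; rewrite eq_sym oner_eq0.
Qed.

(** Gauss's lemma over a valuation ring: rescaled to primitive polynomials, both factors have
    nonzero reductions, hence so has their product; the two scalars are therefore units and [p]
    itself reduces. *)
Lemma place_monic_factor (p q : {poly F}) chi : p \is monic -> q \is monic ->
  place_poly (p * q) chi -> exists P, [/\ place_poly p P, size P = size p & P %| chi].
Proof.
move=> mp mq pqchi.
have [a [a' [P [a0 aa' P0 pP]]]] := place_monic_normalize mp.
have [b [b' [Q [b0 bb' Q0 qQ]]]] := place_monic_normalize mq.
have eqPQ : P * Q = (a' * b') *: chi.
  apply: (@place_poly_inj (a *: p * (b *: q))); first exact: place_polyM.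
  rewrite -scalerAr -scalerAl scalerA mulrC -mul_polyC -[in X in place_poly _ X]mul_polyC.
  by apply: place_polyM pqchi; apply: place_polyC; apply: (placeM pl) aa' bb'.
have ab0 : a' * b' != 0.
  by apply: contra_neq (mulf_neq0 P0 Q0) => ab0; rewrite eqPQ ab0 scale0r.
have a'0 : a' != 0 by apply: contra_neq ab0 => ->; rewrite mul0r.
have b'0 : b' != 0 by apply: contra_neq ab0 => ->; rewrite mulr0.
have pP' : place_poly p (a'^-1 *: P).
  rewrite -[p]scale1r -(mulVf a0) -scalerA -mul_polyC -[in X in place_poly _ X]mul_polyC.
  by apply: place_polyM => //; apply: place_polyC; apply: placeVr.
exists (a'^-1 *: P); split=> //.
  apply/eqP; rewrite eqn_leq; apply/andP; split.
    apply/leq_sizeP => j hj; apply: (place0_eq pl).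
    by rewrite -(nth_default 0 hj); apply: pP'.
  rewrite leqNgt; apply/negP => hlt.
  have sp : (0 < size p)%N by rewrite size_poly_gt0 monic_neq0.
  have := pP' (size p).-1; rewrite -/(lead_coef p) (monicP mp) nth_default; last first.
    by rewrite -ltnS prednK.
  by move=> R10; have := place_inj R10 (place1 pl); apply/eqP; rewrite eq_sym oner_eq0.
rewrite dvdpZl ?invr_neq0 // -(dvdpZr _ _ ab0) -eqPQ.
exact: dvdp_mulIl.
Qed.

End PlaceTheory.

(** * Rational functions and their evaluation at a point *)

Section Fractions.

Lemma subf_div (E : fieldType) (a b a' b' : E) : b != 0 -> b' != 0 ->
  a / b - a' / b' = (a * b' - a' * b) / (b * b').
Proof. by move=> b0 b'0; rewrite -mulNr addf_div // mulNr. Qed.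

Lemma fracE (D : idomainType) (x : {fraction D}) : exists u v : D,
  v != 0 /\ x = FracField.tofrac u / FracField.tofrac v.
Proof.
elim/quotW: x => x; exists (frac x).1, (frac x).2; split; first exact: denom_ratioP.
have d0 := denom_ratioP x.
have n1 : (1 : D) != 0 by apply: oner_neq0.
rewrite -[_ / _]/(FracField.mul _ (FracField.inv _)) !piE.
apply/eqmodP; rewrite /= FracField.equivfE /FracField.mulf /FracField.invf.
by rewrite !numden_Ratio ?mulf_neq0 // mul1r mulr1 mulrC.
Qed.

Lemma frac_lift (D : idomainType) (F : fieldType) (g : {rmorphism D -> F}) :
  injective g -> exists h : {rmorphism {fraction D} -> F},
  forall x, h (FracField.tofrac x) = g x.
Proof.
move=> injg.
have g0 v : v != 0 -> g v != 0 by rewrite -(inj_eq injg) rmorph0.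
have t0 (v : D) : v != 0 -> FracField.tofrac v != 0 by rewrite tofrac_eq0.
have ex (x : {fraction D}) : exists y, exists u v : D,
    [/\ v != 0, x = FracField.tofrac u / FracField.tofrac v & y = g u / g v].
  by have [u [v [v0 ->]]] := fracE x; exists (g u / g v), u, v.
have [h hP] := choice ex.
have hE u v : v != 0 -> h (FracField.tofrac u / FracField.tofrac v) = g u / g v.
  move=> v0; have [u' [v' [v'0 e ->]]] := hP (FracField.tofrac u / FracField.tofrac v).
  apply/eqP; rewrite eqr_div ?g0 // -!rmorphM; apply/eqP; congr (g _).
  apply/eqP; rewrite -tofrac_eq !tofracM -eqr_div ?t0 //.
  by rewrite e.
have hT u : h (FracField.tofrac u) = g u.
  by have := hE u 1 (oner_neq0 _); rewrite tofrac1 rmorph1 !divr1.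
have hB : zmod_morphism h.
  move=> x y; have [u [v [v0 ->]]] := fracE x; have [u' [v' [v'0 ->]]] := fracE y.
  rewrite subf_div ?t0 // -!tofracM -tofracB !hE ?mulf_neq0 //.
  by rewrite rmorphB !rmorphM subf_div ?g0.
have hM : monoid_morphism h.
  split=> [|x y]; first by rewrite -tofrac1 hT rmorph1.
  have [u [v [v0 ->]]] := fracE x; have [u' [v' [v'0 ->]]] := fracE y.
  by rewrite mulf_div -!tofracM !hE ?mulf_neq0 // !rmorphM mulf_div.
pose hA := GRing.isZmodMorphism.Build _ _ h hB.
pose hMM := GRing.isMonoidMorphism.Build _ _ h hM.
pose H : {rmorphism {fraction D} -> F} := HB.pack h hA hMM.
by exists H.
Qed.

Variable F : fieldType.
Local Notation tofrac := (@FracField.tofrac {poly F}).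

Local Notation ratfunc := {fraction {poly F}}.

(** The graph of evaluation on the functions regular at [a]. It asks for just one suitable fraction;
    single-valuedness follows from [evalf_place]. *)
Definition evalf (a : F) (x : ratfunc) (y : F) :=
  exists u v : {poly F}, [/\ v.[a] != 0, x = tofrac u / tofrac v & y = u.[a] / v.[a]].

Lemma evalf_frac a (p : {poly F}) : evalf a (tofrac p) p.[a].
Proof.
by exists p, 1; rewrite hornerC oner_neq0 rmorph1 !divr1.
Qed.

Lemma horner_neq0 (v : {poly F}) a : v.[a] != 0 -> tofrac v != 0.
Proof. by rewrite tofrac_eq0; apply: contraNneq => ->; rewrite horner0. Qed.

Lemma evalf_place a : place (evalf a).
Proof.
split.
- by have := evalf_frac a 1; rewrite rmorph1 hornerC.
- move=> x x' y y' [u [v [v0 -> ->]]] [u' [v' [v'0 -> ->]]].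
  exists (u * v' - u' * v), (v * v'); rewrite hornerM mulf_neq0 //; split=> //.
    by rewrite (subf_div _ _ (horner_neq0 v0) (horner_neq0 v'0)) -!tofracM -tofracB.
  by rewrite hornerD hornerN !hornerM subf_div.
- move=> x x' y y' [u [v [v0 -> ->]]] [u' [v' [v'0 -> ->]]].
  exists (u * u'), (v * v'); rewrite !hornerM mulf_neq0 //; split=> //.
    by rewrite mulf_div !tofracM.
  by rewrite mulf_div.
- move=> y [u [v [v0 e ->]]]; suff -> : u = 0 by rewrite horner0 mul0r.
  apply/eqP; rewrite -tofrac_eq0; move/esym/eqP: e.
  by rewrite mulf_eq0 invr_eq0 (negPf (horner_neq0 v0)) orbF.
move=> x; have [u [v [v0 ->]]] := fracE x.
(* In lowest terms, numerator and denominator have no common root: either the function is regular at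
   [a], or its inverse vanishes there. *)
have g0 : gcdp u v != 0 by rewrite gcdp_eq0 negb_and v0 orbT.
pose u' := u %/ gcdp u v; pose v' := v %/ gcdp u v.
have du : u = u' * gcdp u v by rewrite divpK ?dvdp_gcdl.
have dv : v = v' * gcdp u v by rewrite divpK ?dvdp_gcdr.
have cuv : coprimep u' v' by apply: coprimep_div_gcd; rewrite v0 orbT.
have -> : tofrac u / tofrac v = tofrac u' / tofrac v'.
  move: (gcdp u v) g0 u' v' du dv {cuv} => g g0 u' v' -> ->.
  by rewrite !tofracM -mulf_div divff ?mulr1 ?tofrac_eq0.
have [va0|va0] := eqVneq v'.[a] 0; last by left; exists (u'.[a] / v'.[a]), u', v'.
right; exists v', u'; rewrite invf_div va0 mul0r; split=> //.
rewrite -[_ == 0]/(root u' a); apply: contraL cuv => ua.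
by apply/negP => /coprimep_root /(_ ua); rewrite va0 eqxx.
Qed.

Lemma place_comp (L O : fieldType) (P : F -> L -> Prop) (R : L -> O -> Prop) :
  place P -> place R -> place (fun x z => exists2 y, P x y & R y z).
Proof.
move=> pP pR; split.
- by exists 1; apply: place1.
- move=> x x' z z' [y xy yz] [y' xy' yz'].
  by exists (y - y'); [apply: (placeB pP)|apply: (placeB pR)].
- move=> x x' z z' [y xy yz] [y' xy' yz'].
  by exists (y * y'); [apply: (placeM pP)|apply: (placeM pR)].
- by move=> z [y /(place0_eq pP) -> /(place0_eq pR)].
move=> x; have [[y xy]|x0] := placeV pP x; last by right; exists 0 => //; apply: place0.
have [[z yz]|y0] := placeV pR y; first by left; exists z, y.
have [y_0|y_0] := eqVneq y 0.
  by left; exists 0, y => //; rewrite y_0; apply: place0.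
by right; exists y^-1; first apply: placeVr.
Qed.

Lemma place_rmorph (L O : fieldType) (f : {rmorphism F -> L}) (R : L -> O -> Prop) :
  place R -> place (fun x y => R (f x) y).
Proof.
move=> pR; split.
- by rewrite rmorph1; apply: place1.
- by move=> *; rewrite rmorphB; apply: (placeB pR).
- by move=> *; rewrite rmorphM; apply: (placeM pR).
- by move=> y; rewrite rmorph0; apply: place0_eq.
by move=> x; rewrite fmorphV; apply: placeV.
Qed.

Lemma natr_inj (F0 : has_pchar0 F) : injective (fun k => k%:R : F).
Proof.
have /pcharf0P F0' := F0.
have le i j : (i <= j)%N -> i%:R = j%:R :> F -> i = j.
  move=> ij e; apply/eqP; rewrite eqn_leq ij -subn_eq0 -F0' natrB //.
  by rewrite e subrr eqxx.
by move=> i j; have [/le//|/ltnW/le h e] := leqP i j; rewrite h.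
Qed.

Lemma exists_nonroot (F0 : has_pchar0 F) (w : {poly F}) : w != 0 -> exists a, w.[a] != 0.
Proof.
move=> w0; apply: contrapT => no.
pose rs := [seq i%:R : F | i <- iota 0 (size w)].
have := max_poly_roots w0 (rs := rs).
rewrite size_map size_iota ltnn map_inj_uniq ?iota_uniq; last exact: natr_inj.
suff -> : all (root w) rs by move=> /(_ isT isT).
by apply/allP => a _; apply/negPn/negP => wa; apply: no; exists a.
Qed.

Lemma exists_evalf (F0 : has_pchar0 F) (xs : seq ratfunc) :
  exists a, forall x, x \in xs -> exists y, evalf a x y.
Proof.
suff [w w0 wP] : exists2 w : {poly F}, w != 0 &
    forall a, w.[a] != 0 -> forall x, x \in xs -> exists y, evalf a x y.
  by have [a wa] := exists_nonroot F0 w0; exists a; apply: wP.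
elim: xs => [|x xs [w w0 wP]]; first by exists 1; rewrite ?oner_neq0.
have [u [v [v0 defx]]] := fracE x; exists (v * w); first by rewrite mulf_neq0.
move=> a; rewrite hornerM mulf_eq0 negb_or => /andP[va wa] z.
rewrite inE => /predU1P[->|]; last exact: wP.
by exists (u.[a] / v.[a]), u, v.
Qed.

End Fractions.

(** * Matrices diagonalisable with natural eigenvalues *)

Section NatDiag.
Variable F : fieldType.

Definition natpoly N : {poly F} := \prod_(i < N) ('X - i%:R%:P).

(* In characteristic zero: diagonalisable with eigenvalues in [N], as the factors
   of [natpoly] are then distinct. *)
Definition natdiag n (A : 'M[F]_n) := exists N, mxeval A (natpoly N) = 0.

Lemma natpoly_root N k : (k < N)%N -> (natpoly N).[k%:R] = 0.
Proof.
move=> kN; rewrite horner_prod (bigD1 (Ordinal kN)) //=.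
by rewrite hornerXsubC subrr mul0r.
Qed.

Lemma natpolyX N m : natpoly N ^+ m = \prod_(p : 'I_m * 'I_N) ('X - (p.2%:R : F)%:P).
Proof.
rewrite -(pair_bigA _ (fun (_ : 'I_m) (i : 'I_N) => 'X - (i%:R : F)%:P)) /=.
by rewrite prodr_const card_ord.
Qed.

(** A monic divisor of a product of linear factors is a subproduct, so its roots are natural
    numbers. *)
Lemma polytr_natpoly N m (P : {poly F}) : P \is monic -> P %| natpoly N ^+ m ->
  exists t, polytr P = t%:R.
Proof.
move=> mP; rewrite natpolyX.
case/dvdp_prod_XsubC => b; rewrite eqp_monic ?monic_prod_XsubC // => /eqP ->.
rewrite -(big_map (fun p : 'I_m * 'I_N => p.2%:R) xpredT (fun a => 'X - a%:P)).
rewrite polytr_prod_XsubC big_map -natr_sum.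
by exists (\sum_(i <- mask b (index_enum ('I_m * 'I_N)%type)) i.2)%N.
Qed.

Lemma mxeval_eigen m n (A : 'M[F]_n) (P : 'M_(n, m)) a g :
  A *m P = a *: P -> mxeval A g *m P = g.[a] *: P.
Proof.
move=> AP; elim/poly_ind: g => [|g k IH]; first by rewrite mxeval0 mul0mx horner0 scale0r.
rewrite mxevalD mxevalM mxevalX mxevalC mulmxDl -mulmxA AP -scalemxAr IH.
by rewrite mul_scalar_mx hornerMXaddC scalerDl scalerA mulrC.
Qed.

Lemma irredp_dvdX (p h : {poly F}) k : irreducible_poly p -> p %| h ^+ k -> p %| h.
Proof.
move=> ip; apply: contraTT => /(irredp_coprime ip) cph.
apply/negP => ph; have := coprimep_dvdl ph (coprimep_expr k cph).
by rewrite coprimepp => /eqP s1; case: ip; rewrite s1.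
Qed.

End NatDiag.

(** * From a reduction with natural eigenvalues to a replica *)

Section Specialisation.
Variables (K O : fieldType) (R : K -> O -> Prop) (pl : place R) (O0 : has_pchar0 O).

Let K0 : has_pchar0 K := place_char0 pl O0.

Lemma place_polytr0 (f : {poly K}) : f \is monic ->
  (forall p, irreducible_poly p -> p \is monic -> p %| f -> R (polytr p) 0) ->
  R (polytr f) 0.
Proof.
have [m] := ubnP (size f); elim: m f => // m IH f fm mf irr.
have [s1|s1] := ltnP 1 (size f); last first.
  suff -> : f = 1 by rewrite polytr1; apply: place0.
  apply/eqP; rewrite -eqp_monic ?monic1 // -size_poly_eq1 eqn_leq s1.
  by rewrite size_poly_gt0 monic_neq0.
have [p [ip mp /dvdpP [g defg]]] := irredp_factor s1.
have mg : g \is monic by rewrite -(monicMr _ mp) -defg.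
rewrite defg polytrM // -[X in R _ X]addr0; apply: placeD pl _ _ _ _ _ _.
  apply: IH => //; last by move=> q iq mq qg; apply: irr; rewrite // defg dvdp_mulr.
  move: fm; rewrite defg size_mul ?monic_neq0 //; case: ip => sp _.
  by case: (size p) sp => // -[|a] // _; rewrite !addnS /= ltnS; apply: leq_trans; rewrite ltnS leq_addr.
by apply: irr; rewrite // defg dvdp_mull.
Qed.

(** [D] is the reduction of [A], and [D'] that of the restriction [B] of [A] to the rows of [V]. The
    replica of [A] weighted by [n!] times the reduced average roots works: if it killed [V], every
    irreducible factor of [char_poly B] would have a root sum reducing to 0, forcing
    [\tr D' = 0]. *)
Lemma natdiag_of_place n r (c : 'I_n -> 'M[K]_n) (V : 'M_(r, n)) A B D D' :
    row_free V -> mxder c A -> V *m A = B *m V ->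
    place_mx R A D -> place_mx R B D' -> natdiag D -> \tr D' != 0 ->
  exists E, [/\ mxder c E, natdiag E & V *m E != 0].
Proof.
move=> fV dA VA AD BD' [N DN] trD'.
pose h := char_poly A; have mh : h \is monic := char_poly_monic A.
have n0 : (n`!)%:R != 0 :> O by apply: natr_neq0 => //; apply: fact_gt0.
have deg p : irreducible_poly p -> p \is monic -> p %| h ->
    (0 < (size p).-1 <= n)%N.
  move=> [sp _] mp ph; case: (size p) sp (dvdp_leq (monic_neq0 mh) ph) => // -[|a] // _.
  by rewrite size_char_poly ltnS.
(* The factor [n!] clears the denominator [deg p], at most [n]; the root sum reduces to a natural
   number because, by Gauss's lemma, the reduction of [p] divides [char_poly D]. *)
have ex p : exists t, irreducible_poly p -> p \is monic -> p %| h ->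
    R (n`!%:R * avgroot p) t%:R.
  have [[ip mp ph]|no] := pselect [/\ irreducible_poly p, p \is monic & p %| h]; last first.
    by exists 0 => ip mp ph; case: no.
  have /dvdpP [q defh] := ph; rewrite mulrC in defh.
  have mq : q \is monic by rewrite -(monicMl _ mp) -defh.
  have pqD : place_poly R (p * q) (char_poly D) by rewrite -defh; apply: place_char_poly.
  have [P [pP sP PD]] := place_monic_factor pl mp mq pqD.
  have mP : P \is monic.
    have := pP (size p).-1; rewrite -/(lead_coef p) (monicP mp) -sP => /(place_inj pl) e.
    by rewrite monicE /lead_coef (e 1 (place1 pl)).
  have [t Pt] := polytr_natpoly mP (dvdp_trans PD (char_poly_dvd_exp DN)).
  have /andP[d0 dn] := deg p ip mp ph.
  exists ((n`! %/ (size p).-1) * t)%N => _ _ _.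
  have -> : n`!%:R * avgroot p = (n`! %/ (size p).-1)%:R * polytr p.
    rewrite /avgroot mulrCA mulrC; congr (_ * _).
    by rewrite -{1}(divnK (dvdn_fact (deg p ip mp ph))) natrM mulfK ?natr_neq0.
  by rewrite natrM; apply: (placeM pl); [apply: place_nat|rewrite -Pt; apply: place_polytr].
have [t tP] := choice ex.
have [s [sP sum1]] := primary_idempotents (monic_neq0 mh).
have hA : mxeval A h = 0 by apply: mxeval_char_poly.
(* The weights are natural numbers, determined by their images in [O], where additivity comes from
   the place. *)
have [|dE idE] := @mxder_replica _ K0 _ c A h s (fun p => (t p)%:R) dA hA sP sum1.
  move=> x y z xs ys zs avg; rewrite -natrD; congr (_%:R).
  have [[ix mx xh _] [iy my yh _] [iz mz zh _]] := And3 (sP x xs) (sP y ys) (sP z zs).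
  apply: (natr_inj O0); rewrite natrD; apply: (place_inj pl) (tP _ iz mz zh) _.
  by rewrite avg mulrDr; apply: placeD => //; apply: tP.
move: dE idE; set E := \sum_(z <- s) _ => dE idE; clearbody E.
have I1 : \sum_(z <- s) mxeval A z.2 = 1%:M.
  exact: mxeval_partition hA sum1.
exists E; split=> //.
  exists (\max_(z <- s) t z.1).+1.
  rewrite -[LHS]mulmx1 -I1 mulmx_sumr big_seq big1 // => z zs.
  rewrite (mxeval_eigen _ (idE z zs)) natpoly_root ?scale0r // ltnS.
  exact: (@leq_bigmax_seq _ _ xpredT (fun z : {poly K} * {poly K} => t z.1)).
apply: contra_neq trD' => VE0.
have VAB p : V *m mxeval A p = mxeval B p *m V by rewrite (mxeval_intertwine _ (esym VA)).
have B0 p : V *m mxeval A p = 0 -> mxeval B p = 0.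
  by rewrite VAB => e; apply: (row_free_inj fV); rewrite mul0mx.
apply: (place_inj pl) (place_trace pl BD') _; rewrite -polytr_char_poly.
apply: place_polytr0 => [|p ip mp pB]; first exact: char_poly_monic.
have pdvd g : mxeval B g = 0 -> p %| g.
  by move=> /char_poly_dvd_exp /(dvdp_trans pB) /(irredp_dvdX ip).
have ph : p %| h by apply: pdvd; apply: B0; rewrite hA mulmx0.
(* The polynomials [z.2] sum to 1 modulo [p], so [p] cannot divide all of them. *)
have [z zs npz] : exists2 z, z \in s & ~~ (p %| z.2).
  apply: contrapT => no; case: (ip) => sp _; move: (dvdp_trans ph sum1).
  rewrite dvdp_subr ?dvdp1; first by move/eqP => s1; rewrite s1 in sp.
  rewrite big_seq; elim/big_ind: _ => [|x y|z zs]; rewrite ?dvdp0 //; first exact: dvdp_add.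
  by apply/negPn/negP => npz; apply: no; exists z.
have [iz mz zh [k hk]] := sP z zs.
have defp : p = z.1.
  apply/eqP; rewrite -eqp_monic //; apply: iz.2; first by rewrite gtn_eqF //; case: ip.
  apply: (@irredp_dvdX _ _ _ k) => //; move: (dvdp_trans ph hk).
  by rewrite Gauss_dvdpl // irredp_coprime.
(* If the weight were nonzero, [V *m E = 0] would give [V *m z.2(A) = 0], so [z.2(B) = 0] and
   [p %| z.2]. *)
have tp : (t p)%:R = 0 :> K.
  apply/eqP; apply: contraNT npz => tp; apply/pdvd/B0.
  apply: (scalerI tp); rewrite scaler0 defp scalemxAr -idE //.
  by rewrite mulmxA VE0 mul0mx.
have t0 : t p = 0 by apply: (natr_inj K0); rewrite tp.
have := tP p ip mp ph; rewrite t0 => Ravg.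
have /andP[d0 dn] := deg p ip mp ph.
have -> : polytr p = (size p).-1%:R * n`!%:R^-1 * (n`!%:R * avgroot p).
  rewrite mulrA mulfVK ?natr_neq0 ?fact_gt0 // /avgroot mulrC divfK //.
  exact: natr_neq0.
rewrite -[X in R _ X](mulr0 ((size p).-1%:R * n`!%:R^-1)).
apply: (placeM pl) Ravg; apply: (placeM pl); first exact: place_nat.
by apply: placeVr => //; apply: place_nat.
Qed.

End Specialisation.

(** * Descent of derivations to the base field *)

Section Descent.

Lemma mxderD (K : fieldType) n (c : 'I_n -> 'M[K]_n) A B :
  mxder c A -> mxder c B -> mxder c (A + B).
Proof.
move=> dA dB i; rewrite mulmxDr mulmxDl dA dB addrACA -big_split; congr (_ + _).
by apply: eq_bigr => k _; rewrite mxE scalerDl.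
Qed.

Lemma mxderZ (K : fieldType) n (c : 'I_n -> 'M[K]_n) a A :
  mxder c A -> mxder c (a *: A).
Proof.
move=> dA i; rewrite -scalemxAr -scalemxAl dA scalerDr scaler_sumr; congr (_ + _).
by apply: eq_bigr => k _; rewrite mxE scalerA.
Qed.

Lemma mxder_map (K L : fieldType) (f : {rmorphism K -> L}) n (c : 'I_n -> 'M[K]_n) A :
  mxder c A -> mxder (fun i => map_mx f (c i)) (map_mx f A).
Proof.
move=> dA i; rewrite -!map_mxM dA map_mxD raddf_sum; congr (_ + _).
by apply: eq_bigr => k _; rewrite /= map_mxZ mxE.
Qed.

Lemma mxeval_map (K L : fieldType) (f : {rmorphism K -> L}) n (A : 'M[K]_n) p :
  map_mx f (mxeval A p) = mxeval (map_mx f A) (map_poly f p).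
Proof.
elim/poly_ind: p => [|p k IH]; first by rewrite map_poly0 !mxeval0 map_mx0.
rewrite rmorphD rmorphM /= map_polyX map_polyC !mxevalD !mxevalM !mxevalX !mxevalC.
by rewrite map_mxD map_mxM IH map_scalar_mx.
Qed.

Lemma natpoly_map (K L : fieldType) (f : {rmorphism K -> L}) N :
  map_poly f (natpoly K N) = natpoly L N.
Proof.
rewrite rmorph_prod; apply: eq_bigr => i _.
by rewrite /= rmorphB /= map_polyX map_polyC /= rmorph_nat.
Qed.

Lemma natdiag_map (K L : fieldType) (f : {rmorphism K -> L}) n (A : 'M[K]_n) :
  natdiag A -> natdiag (map_mx f A).
Proof. by case=> N AN; exists N; rewrite -(natpoly_map f) -mxeval_map AN map_mx0. Qed.

Lemma place_natdiag (F O : fieldType) (R : F -> O -> Prop) (pl : place R) n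
    (A : 'M[F]_n) A' : place_mx R A A' -> natdiag A -> natdiag A'.
Proof.
move=> AA [N AN]; exists N.
suff: place_mx R (mxeval A (natpoly F N)) (mxeval A' (natpoly O N)).
  by rewrite AN => h; apply: (place_mx_inj pl) h _ => i j; rewrite !mxE; apply: place0.
elim: {AN} N => [|N IH].
  by rewrite /natpoly !big_ord0 !mxeval1 => i j; rewrite !mxE; apply: place_nat.
rewrite /natpoly !big_ord_recr !mxevalM; apply: place_mulmx => // i j.
rewrite !mxevalB !mxevalX !mxevalC !mxE; apply: (placeB pl) => //.
by apply: placeMn => //; apply: place_nat.
Qed.

Lemma place_mxder (F O : fieldType) (R : F -> O -> Prop) (pl : place R) n
    (c : 'I_n -> 'M[F]_n) c' A A' : (forall i, place_mx R (c i) (c' i)) ->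
  place_mx R A A' -> mxder c A -> mxder c' A'.
Proof.
move=> cc AA dA i; apply: (place_mx_inj pl) (place_mulmx pl (cc i) AA) _.
rewrite dA => j k; rewrite [in X in R X _]mxE [in X in R _ X]mxE.
apply: placeD => //; first exact: place_mulmx.
rewrite !summxE; apply: place_sum => // l _; rewrite !mxE.
by apply: (placeM pl); [apply: AA|apply: cc].
Qed.

(** The point [a] is chosen so that the entries of [E] and the inverse of a nonzero entry of
    [V *m E] are defined there; the inverse keeps that entry from vanishing. *)
Lemma natdiag_specialise (K : fieldType) (K0 : has_pchar0 K) n r
    (c : 'I_n -> 'M[K]_n) (V : 'M[K]_(r, n)) (io : {rmorphism K -> {fraction {poly K}}}) E :
    (forall x, io x = FracField.tofrac x%:P) ->
    mxder (fun i => map_mx io (c i)) E -> natdiag E -> map_mx io V *m E != 0 ->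
  exists E', [/\ mxder c E', natdiag E' & V *m E' != 0].
Proof.
move=> ioE dE nE VE.
have [i [j xij]] : exists i j, (map_mx io V *m E) i j != 0.
  apply: contrapT => no; move/eqP: VE; apply; apply/matrixP => i j; rewrite [RHS]mxE.
  by apply/eqP/negPn/negP => nz; apply: no; exists i, j.
set x := _ i j in xij.
have [a aP] := exists_evalf K0 (x^-1 :: [seq E p.1 p.2 | p : 'I_n * 'I_n]).
have pa := evalf_place a.
have ioP y : evalf a (io y) y by rewrite ioE -[X in evalf a _ X](hornerC y a); apply: evalf_frac.
have exE k l : exists y, evalf a (E k l) y.
  apply: aP; rewrite inE; apply/orP; right.
  by apply/mapP; exists (k, l); rewrite ?mem_enum.
have [g gP] := choice (fun p : 'I_n * 'I_n => exE p.1 p.2).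
pose E' := \matrix_(k, l) g (k, l).
have EE' : place_mx (evalf a) E E' by move=> k l; rewrite mxE; apply: (gP (k, l)).
exists E'; split.
- by apply: (place_mxder pa) EE' dE => k l m; rewrite mxE.
- exact: (place_natdiag pa) EE' nE.
have VV : place_mx (evalf a) (map_mx io V) V by move=> k l; rewrite mxE.
have xx := place_mulmx pa VV EE' i j; rewrite -/x in xx.
have [y xy] := aP x^-1 (mem_head _ _).
apply/eqP => V0; rewrite V0 mxE in xx.
have := placeM pa xx xy; rewrite mul0r divff // => R10.
by have := place_inj pa R10 (place1 pa); apply/eqP; rewrite eq_sym oner_eq0.
Qed.

(* Replacing the coefficients of the combination by indeterminates one at a
   time makes the combination generic, hence defined over a purely
   transcendental extension of [K], with the original one as a reduction. *)
Lemma natdiag_descent m (K L O : fieldType) (f : {rmorphism K -> L}) (R : L -> O -> Prop)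
    n r (c : 'I_n -> 'M[K]_n) (V : 'M[K]_(r, n)) (S : 'M[K]_n) (T : 'M[K]_r)
    (s : seq (L * ('M[K]_n * 'M[K]_r))) (D : 'M[O]_n) (D' : 'M[O]_r) :
    size s = m -> place R -> has_pchar0 O -> row_free V ->
    mxder c S -> V *m S = T *m V ->
    (forall z, z \in s -> mxder c z.2.1 /\ V *m z.2.1 = z.2.2 *m V) ->
    place_mx R (map_mx f S + \sum_(z <- s) z.1 *: map_mx f z.2.1) D ->
    place_mx R (map_mx f T + \sum_(z <- s) z.1 *: map_mx f z.2.2) D' ->
    natdiag D -> \tr D' != 0 ->
  exists E, [/\ mxder c E, natdiag E & V *m E != 0].
Proof.
elim: m K L f R c V S T s D D' => [|m IH] K L f R c V S T s D D' sm pR O0 fV dS VS sP AD BD nD tD.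
  (* With no coefficient left, the combination is defined over [K], and [R] composed with [f] is a
     place of [K]. *)
  move/size0nil: sm AD BD => ->; rewrite !big_nil !addr0 => AD BD.
  have pf := place_rmorph f pR.
  by apply: (natdiag_of_place pf) dS VS _ _ nD tD => // i j; [have := AD i j|have := BD i j]; rewrite mxE.
case: s sm sP AD BD => [//|[a [S1 T1]] s] [sm] sP; rewrite !big_cons /= => AD BD.
pose KK : fieldType := {fraction {poly K}}; pose LL : fieldType := {fraction {poly L}}.
pose io : {rmorphism K -> KK} := (@FracField.tofrac {poly K} \o polyC)%FUN.
pose jo : {rmorphism L -> LL} := (@FracField.tofrac {poly L} \o polyC)%FUN.
have [h hE] : exists h : {rmorphism KK -> LL},
    forall p, h (FracField.tofrac p) = FracField.tofrac (map_poly f p).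
  apply: (frac_lift (g := (@FracField.tofrac {poly L} \o map_poly f)%FUN)) => p q /= /eqP.
  by rewrite tofrac_eq => /eqP /(map_inj_poly (fmorph_inj f) (rmorph0 f)).
pose t : KK := FracField.tofrac 'X; pose u : LL := FracField.tofrac 'X.
have ht : h t = u by rewrite hE map_polyX.
have hio k l (X : 'M_(k, l)) : map_mx h (map_mx io X) = map_mx jo (map_mx f X).
  by apply/matrixP => i j; rewrite !mxE /= hE map_polyC.
have joP x : evalf a (jo x) x by rewrite -[X in evalf a _ X](hornerC x a); apply: evalf_frac.
have ua : evalf a u a by rewrite -[X in evalf a _ X](hornerX a); apply: evalf_frac.
have pa := evalf_place a.
have K0 : has_pchar0 K := place_char0 (place_rmorph f pR) O0.
have [dS1 VS1] := sP _ (mem_head _ _).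
(* Evaluating the indeterminate at [a] turns the modified combination back into the given one, which
   [R] then reduces to [W]. *)
have step k l (X0 X1 : 'M[K]_(k, l)) (w : L * ('M[K]_n * 'M[K]_r) -> 'M[K]_(k, l)) W :
    place_mx R (map_mx f X0 + (a *: map_mx f X1 + \sum_(z <- s) z.1 *: map_mx f (w z))) W ->
    place_mx (fun x z => exists2 y, evalf a x y & R y z)
      (map_mx h (map_mx io X0 + t *: map_mx io X1)
        + \sum_(z <- s) jo z.1 *: map_mx h (map_mx io (w z))) W.
  move=> XW i j; have := XW i j; set y := (X in R X _) => yW; exists y => //; rewrite {yW}/y.
  rewrite map_mxD map_mxZ ht !hio addrA !mxE !summxE.
  apply: placeD => //.
    by apply: placeD => //; apply: (placeM pa).
  by apply: place_sum => // z _; rewrite hio !mxE; apply: (placeM pa).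
pose s' := [seq (jo z.1, (map_mx io z.2.1, map_mx io z.2.2)) | z <- s].
(* The first coefficient becomes the indeterminate [t] and joins the fixed part; the remaining ones
   are constants of [LL]. *)
have [|||||||||||E [dE nE VE]] := @IH KK LL h (fun x z => exists2 y, evalf a x y & R y z)
  (fun i => map_mx io (c i)) (map_mx io V)
  (map_mx io S + t *: map_mx io S1) (map_mx io T + t *: map_mx io T1) s' D D'.
- by rewrite size_map.
- exact: place_comp.
- by [].
- by rewrite row_free_map.
- by apply: mxderD; [|apply: mxderZ]; apply: mxder_map.
- by rewrite mulmxDr mulmxDl -scalemxAr -scalemxAl -!map_mxM VS VS1.
- move=> _ /mapP[z zs ->] /=; have [|dz Vz] := sP z; first by rewrite inE zs orbT.
  by split; [apply: mxder_map|rewrite -!map_mxM Vz].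
- by rewrite big_map /=; apply: step.
- by rewrite big_map /=; apply: (step _ _ _ _ (fun z => z.2.2)).
- by [].
- by [].
by apply: (natdiag_specialise K0 (io := io)) dE nE VE.
Qed.

End Descent.

(** * Stability of the common kernel under derivations *)

Section Stability.
Variables (K : fieldType) (K0 : has_pchar0 K) (n : nat).
Implicit Types (A D E F Y : 'M[K]_n) (x : 'rV[K]_n) (a : K).
Local Notation natpoly := (natpoly K).

Lemma mxeval_shift A a p : mxeval (A + a%:M) p = mxeval A (p \Po ('X + a%:P)).
Proof.
elim/poly_ind: p => [|p k IH]; first by rewrite comp_poly0 !mxeval0.
rewrite comp_polyD comp_polyM comp_polyX comp_polyC !mxevalD !mxevalM IH.
by rewrite mxevalD !mxevalX !mxevalC.
Qed.

Lemma mxeval_eigenr m A (P : 'M_(m, n)) a g :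
  P *m A = a *: P -> P *m mxeval A g = g.[a] *: P.
Proof.
move=> PA; rewrite -(mxeval_intertwine (A := a%:M)) ?mul_scalar_mx //.
by rewrite (mxeval_eigen (a := a)) // ?mul_scalar_mx.
Qed.

Lemma natpoly_recr N : natpoly N.+1 = natpoly N * ('X - N%:R%:P).
Proof. by rewrite /natpoly big_ord_recr. Qed.

(** [g] is coprime to [natpoly N], whose factors are peeled off from the largest root down. *)
Lemma natpoly_cancel m (Y : 'M_(m, n)) D N g :
  Y *m mxeval D (natpoly N) = 0 -> Y *m mxeval D g = 0 ->
  (forall i, (i < N)%N -> g.[i%:R] != 0) -> Y = 0.
Proof.
move=> YN Yg; elim: N YN => [|N IH] YN gN.
  by move: YN; rewrite /natpoly big_ord0 mxeval1 mulmx1.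
apply: IH => [|i iN]; last by apply: gN; rewrite ltnW.
set Z := _ *m _; have ZD : Z *m D = N%:R *: Z.
  apply/eqP; rewrite -subr_eq0 -mul_mx_scalar -mulmxBr; apply/eqP.
  by rewrite -YN natpoly_recr mxevalM mxevalB mxevalX mxevalC mulmxA.
apply: (scalerI (gN N (ltnSn N))); rewrite scaler0 -(mxeval_eigenr _ ZD).
by rewrite /Z -mulmxA mxeval_comm mulmxA Yg mul0mx.
Qed.

(** [F] shifts the eigenvalues of [D] by a nonzero integer, so it is nilpotent, and [exp(F / a)]
    conjugates [D] to [D + F]. *)
Lemma natdiag_add_shift D F a k :
    natdiag D -> (0 < k)%N -> a = k%:R \/ a = - k%:R ->
    D *m F = F *m (D + a%:M) -> natdiag (D + F).
Proof.
move=> [N DN] k0 aE DF.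
have a0 : a != 0 by case: aE => ->; rewrite ?oppr_eq0 natr_neq0.
have DFm m : D *m F ^+ m = F ^+ m *m (D + (a *+ m)%:M).
  elim: m => [|m IH]; first by rewrite expr0 mulr0n raddf0 addr0 mulmx1 mul1mx.
  rewrite exprSr [_ * _]/(_ *m _) mulmxA IH -!mulmxA; congr (_ *m _).
  rewrite mulmxDl DF mulmxDr mul_mx_scalar mul_scalar_mx mulmxDr mul_mx_scalar.
  by rewrite mulrS scalerDl addrA.
(* [F ^+ N] shifts eigenvalues by at least [N] in absolute value, which leaves the range
   [0, ..., N - 1]. *)
have FN : F ^+ N = 0.
  apply: (@natpoly_cancel _ _ D N (natpoly N \Po ('X + (a *+ N)%:P))).
  - by rewrite DN mulmx0.
  - by rewrite -mxeval_shift -(mxeval_intertwine _ (DFm N)) DN mul0mx.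
  move=> i iN; rewrite horner_comp hornerD hornerX hornerC horner_prod.
  apply/prodf_neq0 => j _; rewrite hornerXsubC subr_eq0.
  have Nk : (N <= k * N)%N by rewrite leq_pmull.
  case: aE => ->; last first.
    rewrite mulNrn subr_eq -mulrnA -natrD (inj_eq (natr_inj K0)) ltn_eqF //.
    by rewrite (leq_trans iN) // (leq_trans Nk) // leq_addl.
  rewrite -mulrnA -natrD (inj_eq (natr_inj K0)) gtn_eqF //.
  by rewrite (leq_trans (ltn_ord j)) // (leq_trans Nk) // leq_addl.
(* The coefficients of [exp(F / a)]; the recursion [eS] matches the two sides of [PDF] after an
   index shift. *)
pose e m : K := (a ^+ m * m`!%:R)^-1.
have eS m : e m.+1 * (a *+ m.+1) = e m.
  have m0 : m.+1%:R != 0 :> K by apply: natr_neq0.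
  have f0 : m`!%:R != 0 :> K by rewrite natr_neq0 // fact_gt0.
  rewrite /e factS natrM exprSr -[a *+ _]mulr_natr.
  by field; rewrite f0 expf_neq0 // a0 addrC natr1 m0.
pose P := \sum_(m < N.+1) e m *: F ^+ m.
have PDF : D *m P = P *m (D + F).
  rewrite mulmx_sumr mulmx_suml.
  have -> : \sum_(m < N.+1) D *m (e m *: F ^+ m) =
      \sum_(m < N.+1) e m *: F ^+ m *m D + \sum_(m < N.+1) (e m * (a *+ m)) *: F ^+ m.
    rewrite -big_split; apply: eq_bigr => m _ /=.
    by rewrite -scalemxAr DFm mulmxDr mul_mx_scalar scalerDr scalerA -scalemxAl.
  have -> : \sum_(m < N.+1) e m *: F ^+ m *m (D + F) =
      \sum_(m < N.+1) e m *: F ^+ m *m D + \sum_(m < N.+1) e m *: F ^+ m.+1.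
    rewrite -big_split; apply: eq_bigr => m _ /=.
    by rewrite mulmxDr -[_ *m F]scalemxAl [F ^+ m.+1]exprSr.
  congr (_ + _); rewrite big_ord_recl mulr0n mulr0 scale0r add0r.
  rewrite [RHS]big_ord_recr /= exprS FN mulr0 scaler0 addr0.
  by apply: eq_bigr => m _; rewrite /= eS.
(* [P] is the identity plus a nilpotent matrix: [F ^+ (N - j) *m Y] vanishes for larger and larger
   [j]. *)
have Pinj Y : P *m Y = 0 -> Y = 0.
  move=> PY; suff FY j : (j <= N)%N -> F ^+ (N - j) *m Y = 0.
    by have := FY N (leqnn N); rewrite subnn expr0 mul1mx.
  elim: j => [|j IH] jN; first by rewrite subn0 FN mul0mx.
  have := congr1 (mulmx (F ^+ (N - j.+1))) PY; rewrite mulmx0 mulmx_suml mulmx_sumr.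
  rewrite big_ord_recl /e expr0 mul1r fact0 invr1 scale1r mul1mx.
  rewrite big1 ?addr0 // => m _; rewrite -scalemxAl -scalemxAr mulmxA.
  rewrite -[F ^+ (N - j.+1) *m _]/(F ^+ (N - j.+1) * _) -exprD.
  rewrite lift0 -addSnnS -subSn // subSS addnC exprD -mulmxA IH ?mulmx0 ?scaler0 //.
  exact: ltnW.
exists N; apply: Pinj; by rewrite -(mxeval_intertwine _ PDF) DN mul0mx.
Qed.

(** The Lagrange idempotents at the roots of [natpoly N], built one root at a time by a Bezout
    relation. *)
Lemma natpoly_idempotents N : exists l : nat -> {poly K},
  natpoly N %| \sum_(i < N) l i - 1 /\
  forall i, (i < N)%N -> natpoly N %| ('X - i%:R%:P) * l i.
Proof.
elim: N => [|N [l [l1 lN]]]; first by exists (fun=> 0); rewrite /natpoly big_ord0 dvd1p.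
have cp : coprimep (natpoly N) ('X - N%:R%:P).
  rewrite coprimep_XsubC /root horner_prod; apply/prodf_neq0 => i _.
  by rewrite hornerXsubC subr_eq0 (inj_eq (natr_inj K0)) gtn_eqF.
have [[u v] /= uv] := Bezout_eq1_coprimepP _ _ cp.
exists (fun i => if i == N then u * natpoly N else l i * (v * ('X - N%:R%:P))).
rewrite natpoly_recr; split=> [|i].
  rewrite big_ord_recr /= eqxx; under eq_bigr => i _ do rewrite ltn_eqF //.
  rewrite -mulr_suml.
  have -> : (\sum_(i < N) l i) * (v * ('X - N%:R%:P)) + u * natpoly N - 1
    = (\sum_(i < N) l i - 1) * ('X - N%:R%:P) * v by rewrite -[in LHS]uv; ring.
  by rewrite dvdp_mulr // dvdp_mul.
rewrite ltnS leq_eqVlt; case: eqP => [-> _|_ /= iN].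
  by rewrite mulrCA dvdp_mull // mulrC.
by rewrite (mulrA _ (l i)); apply: dvdp_mul; [apply: lN|apply: dvdp_mulIr].
Qed.

Variable c : 'I_n -> 'M[K]_n.

Lemma mxder_comm A B : mxder c A -> mxder c B -> mxder c (A *m B - B *m A).
Proof.
move=> /mxderP dA /mxderP dB; apply/mxderP => u.
have AB (X Z : 'M_n) : (forall v, mxad c v *m X = X *m mxad c v + mxad c (v *m X)) ->
    (forall v, mxad c v *m Z = Z *m mxad c v + mxad c (v *m Z)) ->
  mxad c u *m (X *m Z) = X *m Z *m mxad c u + mxad c (u *m (X *m Z))
    + (X *m mxad c (u *m Z) + Z *m mxad c (u *m X)).
  move=> hA hB; rewrite mulmxA hA mulmxDl -mulmxA hB hB mulmxDr !mulmxA -!addrA.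
  by congr (_ + _); rewrite addrA addrC.
rewrite mulmxBr mulmxBl mulmxBr.
have -> : mxad c (u *m (A *m B) - u *m (B *m A)) = mxad c (u *m (A *m B)) - mxad c (u *m (B *m A)).
  by rewrite mxadD -scaleN1r mxadZ scaleN1r.
rewrite (AB _ _ dA dB) (AB _ _ dB dA) [B *m mxad _ _ + _]addrC opprD addrACA subrr addr0.
by rewrite opprD addrACA.
Qed.

(** For [b > 0], the component of [E] of weight [- b] under [ad D] can be added to [D], and the sum
    still kills [x]. Hence [x *m E] has no component of eigenvalue [b] for [D]; only eigenvalue 0
    remains. *)
Lemma natdiag_kernel_stable x E :
    (forall D, mxder c D -> natdiag D -> x *m D = 0) -> mxder c E ->
  forall D, mxder c D -> natdiag D -> x *m E *m D = 0.
Proof.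
move=> xX dE D dD nD; have [N DN] := nD.
pose T Y := D *m Y - Y *m D.
(* The operators [T - j], for [j] in [s], applied to [E]: the result is a derivation without the
   weights listed in [s]. *)
pose Ys := foldr (fun j Y => T Y - j *: Y) E.
have dYs s : mxder c (Ys s).
  elim: s => //= j s IH; rewrite -scaleNr.
  by apply: mxderD; [apply: mxder_comm|apply: mxderZ].
(* Since [x *m D = 0], applying [T - j] to [Y] multiplies [x *m Y] on the right by [- (D + j)]. *)
pose g s : {poly K} := \prod_(j <- s) (- ('X + j%:P)).
have xYs s : x *m Ys s = x *m E *m mxeval D (g s).
  elim: s => [|j s IH]; first by rewrite /g big_nil mxeval1 mulmx1.
  rewrite /= /T !mulmxBr (mulmxA x D) (xX D dD nD) mul0mx sub0r /g big_cons -/(g s) mulrC mxevalM.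
  rewrite (mulmxA _ (mxeval D (g s))) -IH mxevalN mxevalD mxevalX mxevalC mulmxN mulmxDr mul_mx_scalar.
  by rewrite opprD mulmxA -scalemxAr.
have [l [l1 lN]] := natpoly_idempotents N.
pose P i := mxeval D (l i).
have P1 : \sum_(i < N) P i = 1%:M.
  exact: mxeval_partition DN l1.
have DP i : (i < N)%N -> D *m P i = i%:R *: P i.
  by move=> iN; apply: mxeval_XsubC_eigen DN (lN i iN).
have PD i : (i < N)%N -> P i *m D = i%:R *: P i by move=> iN; rewrite mxeval_commX DP.
(* The block [P i *m E *m P j] is scaled by [i - j] under [T]. *)
have YsE s : Ys s = \sum_(i < N) \sum_(j < N)
    (\prod_(b <- s) (i%:R - j%:R - b)) *: (P i *m E *m P j).
  elim: s => [|b s IH].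
    rewrite /= -[LHS]mul1mx -P1 mulmx_suml; apply: eq_bigr => i _.
    under eq_bigr => j _ do rewrite big_nil scale1r.
    by rewrite -mulmx_sumr P1 mulmx1.
  rewrite /= IH /T mulmx_sumr mulmx_suml scaler_sumr -!sumrB; apply: eq_bigr => i _.
  rewrite mulmx_sumr mulmx_suml scaler_sumr -!sumrB; apply: eq_bigr => j _.
  have DM : D *m (P i *m E *m P j) = i%:R *: (P i *m E *m P j).
    by rewrite !mulmxA DP // -!scalemxAl.
  have MD : P i *m E *m P j *m D = j%:R *: (P i *m E *m P j).
    by rewrite -mulmxA PD // -scalemxAr.
  rewrite big_cons -scalemxAr -scalemxAl DM MD !scalerA -!scalerBl.
  by congr (_ *: _); ring.
have key b : (0 < b)%N -> exists2 h : {poly K}, h.[b%:R] != 0 & x *m E *m mxeval D h = 0.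
  move=> b0.
  (* All weights [i - j] other than [- b]: only weight [- b] survives in [Ys s], and [g s] does not
     vanish at [b]. *)
  pose s : seq K := [seq p.1%:R - p.2%:R |
    p : 'I_N * 'I_N <- enum {: 'I_N * 'I_N} & (p.1 + b != p.2)%N].
  exists (g s).
    rewrite /g horner_prod prodf_seq_neq0; apply/allP => _ /mapP[[i j] + ->] /=.
    rewrite mem_filter => /andP[/= ij _].
    rewrite hornerN hornerD hornerX hornerC oppr_eq0 addrA subr_eq0 -natrD.
    by rewrite (inj_eq (natr_inj K0)) addnC.
  have Ts : T (Ys s) = - b%:R *: Ys s.
    apply/eqP; rewrite -subr_eq0; apply/eqP; rewrite -[LHS]/(Ys (- b%:R :: s)).
    rewrite YsE big1 // => i _; rewrite big1 // => j _.
    suff -> : \prod_(k <- (- b%:R :: s)) (i%:R - j%:R - k) = 0 :> K by rewrite scale0r.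
    apply/eqP; rewrite prodf_seq_eq0; apply/hasP.
    have [ij|ij] := eqVneq (i + b)%N j.
      by exists (- b%:R); rewrite ?mem_head //= opprK -ij natrD; apply/eqP; ring.
    exists (i%:R - j%:R); last by rewrite /= subrr.
    rewrite inE; apply/orP; right; apply/mapP; exists (i, j) => //.
    by rewrite mem_filter mem_enum andbT.
  rewrite -xYs; have nDY : natdiag (D + Ys s).
    apply: (natdiag_add_shift (a := - b%:R) nD b0); first by right.
    rewrite mulmxDr mul_mx_scalar -Ts /T addrC subrK //.
  have := xX (D + Ys s) (mxderD dD (dYs s)) nDY.
  by rewrite mulmxDr xX // add0r.
case: N DN {l l1 lN P P1 DP PD YsE} => [|N] DN.
  by move: DN; rewrite /natpoly big_ord0 mxeval1 => e; rewrite -[D]mul1mx e mul0mx mulmx0.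
(* The roots [N, ..., 1] of [natpoly N.+1] are removed one after the other, which leaves the factor
   ['X]. *)
suff red M : (M <= N)%N -> x *m E *m mxeval D (natpoly (N - M).+1) = 0.
  by have := red N (leqnn N); rewrite subnn /natpoly big_ord1 subr0 mxevalX.
elim: M => [|M IH] MN; first by rewrite subn0 DN mulmx0.
have [|h hb hE] := key (N - M)%N; first by rewrite subn_gt0.
have e : (N - M.+1).+1 = (N - M)%N by rewrite -subSn // subSS.
move: (IH (ltnW MN)); rewrite e natpoly_recr; set b := (N - M)%N in hb hE *.
rewrite mxevalM mulmxA; set Z := x *m E *m _ => ZD.
have Zb : Z *m D = b%:R *: Z.
  apply/eqP; rewrite -subr_eq0 -mul_mx_scalar -mulmxBr.
  by move: ZD; rewrite mxevalB mxevalX mxevalC => ->.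
apply: (scalerI hb); rewrite scaler0 -(mxeval_eigenr _ Zb).
by rewrite /Z -mulmxA mxeval_comm mulmxA hE mul0mx.
Qed.

End Stability.

(** * Extension of scalars for derivations in matrix form *)

Section BaseChange.
Variables (K L : fieldType) (f : {rmorphism K -> L}) (n : nat).

Lemma mulmx_funlin (F : fieldType) m k (phi : 'rV[F]_m -> 'rV[F]_k) u :
  linear phi -> u *m \matrix_i phi (delta_mx 0 i) = phi u.
Proof.
move=> lphi; pose phiA := GRing.isLinear.Build _ _ _ _ phi lphi.
pose phiL : {linear 'rV[F]_m -> 'rV[F]_k} := HB.pack phi phiA.
rewrite mulmx_sum_row [in RHS](row_sum_delta u) -[phi]/(phiL : _ -> _) linear_sum.
by apply: eq_bigr => i _; rewrite rowK linearZ.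
Qed.

(** The failure of the Leibniz rule, flattened to a row vector so that derivations form the kernel
    of one matrix. *)
Definition mxder_defect (F : fieldType) (c : 'I_n -> 'M[F]_n) (v : 'rV_(n * n)) :
    'rV_(n * (n * n)) :=
  mxvec (\matrix_i mxvec (c i *m vec_mx v - vec_mx v *m c i
                          - \sum_k vec_mx v i k *: c k)).

Lemma mxder_defectP (F : fieldType) (c : 'I_n -> 'M[F]_n) A :
  mxder c A <-> mxder_defect c (mxvec A) = 0.
Proof.
rewrite /mxder_defect mxvecK; split=> [dA|/(congr1 vec_mx)].
  rewrite -[RHS](linear0 mxvec); congr mxvec; apply/row_matrixP => i.
  by rewrite rowK dA -addrA -opprD subrr linear0 row0.
rewrite mxvecK linear0 => e i; have := congr1 (row i) e.
rewrite rowK row0 => /(congr1 vec_mx); rewrite mxvecK linear0 => /eqP.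
by rewrite subr_eq0 subr_eq addrC => /eqP.
Qed.

Lemma mxder_defect_linear (F : fieldType) (c : 'I_n -> 'M[F]_n) : linear (mxder_defect c).
Proof.
have mxvecP m k a (X Y : 'M[F]_(m, k)) : a *: mxvec X + mxvec Y = mxvec (a *: X + Y).
  by rewrite linearP.
move=> a u v; rewrite /mxder_defect mxvecP; congr mxvec; apply/row_matrixP => i.
rewrite [RHS]linearP /= !rowK mxvecP; congr mxvec; rewrite [vec_mx _]linearP /=.
set U := vec_mx u; set V := vec_mx v.
have -> : \sum_k (a *: U + V) i k *: c k = a *: \sum_k U i k *: c k + \sum_k V i k *: c k.
  rewrite scaler_sumr -big_split; apply: eq_bigr => k _.
  by rewrite !mxE scalerDl scalerA.
rewrite mulmxDr mulmxDl -scalemxAr -scalemxAl !opprD !scalerBr.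
by rewrite (addrACA (a *: _)) (addrACA (a *: _ - _)).
Qed.

(** Derivations solve a linear system with coefficients in [K], and kernels commute with field
    extension. *)
Lemma mxder_ext (c : 'I_n -> 'M[K]_n) (D : 'M[L]_n) :
  mxder (fun i => map_mx f (c i)) D -> exists s : seq (L * 'M[K]_n),
  (forall z, z \in s -> mxder c z.2) /\ D = \sum_(z <- s) z.1 *: map_mx f z.2.
Proof.
move=> /mxder_defectP; rewrite -mulmx_funlin; last exact: mxder_defect_linear.
set M := \matrix_i _; pose M0 := \matrix_i mxder_defect c (delta_mx 0 i).
have -> : M = map_mx f M0.
  apply/row_matrixP => i; rewrite -map_row !rowK /mxder_defect map_mxvec; congr mxvec.
  apply/row_matrixP => j; rewrite -map_row !rowK map_mxvec; congr mxvec.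
  have -> : vec_mx (delta_mx 0 i) = map_mx f (vec_mx (delta_mx 0 i)) :> 'M_n.
    by rewrite map_vec_mx map_delta_mx.
  rewrite map_mxB map_mxB !map_mxM; congr (_ - _); rewrite raddf_sum.
  by apply: eq_bigr => k _; rewrite /= map_mxZ [in LHS]mxE.
move/sub_kermxP; rewrite -map_kermx => /submxP [y Dy].
exists [seq (y 0 i, vec_mx (row i (kermx M0))) | i <- enum 'I_(n * n)]; split.
  move=> _ /mapP[i _ ->] /=; apply/mxder_defectP; rewrite vec_mxK.
  rewrite -mulmx_funlin; last exact: mxder_defect_linear.
  by rewrite -row_mul mulmx_ker row0.
rewrite big_map /= big_enum -[LHS]mxvecK Dy mulmx_sum_row linear_sum.
by apply: eq_bigr => i _; rewrite linearZ /= -map_row map_vec_mx.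
Qed.

(** The trace is a sum of natural eigenvalues, so in characteristic zero they all vanish; a
    nilpotent diagonalisable matrix is 0. *)
Lemma natdiag_trace0 (F : fieldType) (F0 : has_pchar0 F) m (B : 'M[F]_m) : natdiag B -> \tr B = 0 -> B = 0.
Proof.
move=> [N BN] tr0.
have [k Bk] : exists k, mxeval B ('X ^+ k) = 0.
  have := char_poly_dvd_exp BN; rewrite natpolyX.
  case/dvdp_prod_XsubC => b; rewrite eqp_monic ?char_poly_monic ?monic_prod_XsubC // => /eqP defB.
  exists (size (mask b (index_enum ('I_m * 'I_N)%type))).
  move: (mxeval_char_poly B) tr0; rewrite -polytr_char_poly defB.
  rewrite -(big_map (fun p : 'I_m * 'I_N => p.2%:R) xpredT (fun a => 'X - a%:P)).
  rewrite polytr_prod_XsubC !big_map -natr_sum => B0 s0.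
  rewrite -B0; congr mxeval; rewrite big_seq (eq_bigr (fun=> 'X)) -?big_seq.
    by rewrite big_const_seq count_predT iter_mulr_1.
  move=> p ps; suff -> : p.2 = 0%N :> nat by rewrite subr0.
  have /eqP : (\sum_(j <- mask b (index_enum ('I_m * 'I_N)%type)) j.2 = 0)%N.
    by apply: (natr_inj F0); rewrite s0.
  rewrite sum_nat_seq_eq0 => /allP /(_ p ps) /=.
  by move/eqP.
case: N BN => [|N] BN.
  by move: BN; rewrite /natpoly big_ord0 mxeval1 => e; rewrite -[B]mul1mx e mul0mx.
(* ['X * g] kills [B] and [g] is nonzero at 0, which lowers the exponent [k] down to 1. *)
pose g : {poly F} := \prod_(i < N) ('X - i.+1%:R%:P).
have BgB : B *m mxeval B g = 0.
  by rewrite -BN /natpoly big_ord_recl subr0 mxevalM mxevalX.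
have g0 : g.[0] != 0.
  rewrite horner_prod; apply/prodf_neq0 => i _.
  by rewrite hornerXsubC sub0r oppr_eq0 natr_neq0.
elim: k Bk => [|k IH] Bk.
  by move: Bk; rewrite expr0 mxeval1 => e; rewrite -[B]mul1mx e mul0mx.
case: k IH Bk => [|k] IH Bk; first by rewrite -(mxevalX B) -(expr1 'X).
apply: IH; apply: (scalerI g0); rewrite scaler0.
rewrite -(mxeval_eigenr (A := B)); first by rewrite exprSr mxevalM mxevalX -mulmxA BgB mulmx0.
by move: Bk; rewrite exprSr mxevalM mxevalX => ->; rewrite scale0r.
Qed.

(** By finite dimension, finitely many members of [P] already cut out the common kernel, and finite
    intersections of kernels commute with extension of scalars. *)
Lemma common_kernel (P : 'M[K]_n -> Prop) : exists V : 'M[K]_n,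
  [/\ forall A, P A -> V *m A = 0,
      forall x : 'rV_n, (forall A, P A -> x *m A = 0) -> (x <= V)%MS &
      forall u : 'rV_n, (forall A, P A -> u *m map_mx f A = 0) -> (u <= map_mx f V)%MS].
Proof.
suff claim m (V : 'M[K]_n) : (\rank V < m)%N ->
    (forall x : 'rV_n, (forall A, P A -> x *m A = 0) -> (x <= V)%MS) ->
    (forall u : 'rV_n, (forall A, P A -> u *m map_mx f A = 0) -> (u <= map_mx f V)%MS) ->
  exists V' : 'M[K]_n, [/\ forall A, P A -> V' *m A = 0,
      forall x : 'rV_n, (forall A, P A -> x *m A = 0) -> (x <= V')%MS &
      forall u : 'rV_n, (forall A, P A -> u *m map_mx f A = 0) -> (u <= map_mx f V')%MS].
  apply: (claim n.+1 1%:M) => [|x _|u _]; rewrite ?ltnS ?rank_leq_row ?submx1 //.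
  by rewrite map_mx1 submx1.
elim: m V => // m IH V rV xV uV.
have [VP|/existsNP[A /not_implyP[PA VA]]] := pselect (forall A, P A -> V *m A = 0).
  by exists V.
apply: (IH (V :&: kermx A)%MS) => [|x xP|u uP].
- rewrite -ltnS; apply: leq_trans rV; rewrite ltnS; apply: rank_ltmx.
  rewrite ltmxE capmxSl sub_capmx submx_refl /=.
  by apply/sub_kermxP.
- by rewrite sub_capmx xV //; apply/sub_kermxP/xP.
by rewrite map_capmx map_kermx sub_capmx uV //; apply/sub_kermxP/uP.
Qed.

(** A nonzero restriction of [D] to the extension of [V] would have nonzero trace, and descent would
    give a derivation over [K] with natural eigenvalues that does not kill [V]. *)
Lemma natdiag_ext_eq0 (K0 : has_pchar0 K) (c : 'I_n -> 'M[K]_n) (V : 'M[K]_n) (D : 'M[L]_n) :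
    (forall A, mxder c A -> natdiag A -> V *m A = 0) ->
    (forall A, mxder c A -> (V *m A <= V)%MS) ->
    mxder (fun i => map_mx f (c i)) D -> natdiag D -> map_mx f V *m D = 0.
Proof.
move=> VX Vst dD nD; apply: contrapT => VD.
have L0 : has_pchar0 L by move=> p; rewrite (fmorph_pchar f); apply: K0.
pose W := row_base V.
have eW m (Y : 'M_(n, m)) : map_mx f W *m Y = 0 -> map_mx f V *m Y = 0.
  move=> WY; have /submxP[Z ->] : (V <= W)%MS by rewrite eq_row_base.
  by rewrite map_mxM -mulmxA WY mulmx0.
have fW : row_free W := row_base_free V.
have WX A : mxder c A -> natdiag A -> W *m A = 0.
  move=> dA nA; have /submxP[Z ->] : (W <= V)%MS by rewrite eq_row_base.
  by rewrite -mulmxA VX // mulmx0.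
pose T A := W *m A *m pinvmx W.
have TE A : mxder c A -> W *m A = T A *m W.
  move=> dA; rewrite /T mulmxKpV // eq_row_base.
  have /submxP[Z ->] : (W <= V)%MS by rewrite eq_row_base.
  by rewrite -mulmxA mulmx_sub // Vst.
have [s [sP defD]] := mxder_ext dD.
pose D' := \sum_(z <- s) z.1 *: map_mx f (T z.2).
have WD : map_mx f W *m D = D' *m map_mx f W.
  rewrite defD mulmx_sumr mulmx_suml !big_seq; apply: eq_bigr => z zs.
  by rewrite -scalemxAr -scalemxAl -!map_mxM TE //; apply: sP.
have nD' : natdiag D'.
  have [N DN] := nD; exists N.
  have fW' : row_free (map_mx f W) by rewrite row_free_map.
  apply: (row_free_inj fW'); rewrite mul0mx.
  by rewrite (mxeval_intertwine _ (esym WD)) DN mulmx0.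
have tD' : \tr D' != 0.
  apply: contra_notN VD => /eqP tr0; have D'0 := natdiag_trace0 L0 nD' tr0.
  by apply: eW; rewrite WD D'0 mul0mx.
(* Descent starts from the trivial place of [L] and a zero fixed part. *)
have plid : place (@eq L).
  by split=> // [x x' y y' -> ->|x x' y y' -> ->|x]; rewrite //; left; exists x.
pose s' := [seq (z.1, (z.2, T z.2)) | z <- s].
have [|||||||E [dE nE WE]] := @natdiag_descent (size s') K L L f eq n _ c W 0 0 s' D D'
  erefl plid L0 fW.
- by move=> i; rewrite mulmx0 mul0mx add0r big1 // => k _; rewrite mxE scale0r.
- by rewrite mulmx0 mul0mx.
- by move=> _ /mapP[z zs ->] /=; split; [apply: sP|apply/TE/sP].
- by rewrite big_map /= map_mx0 add0r -defD.
- by rewrite big_map /= map_mx0 add0r.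
- by [].
- by [].
by rewrite WX ?eqxx in WE.
Qed.

(** Left to right, testing [u] on the derivations that come from [K] is enough; right to left, the
    common kernel over [K] is stable under all derivations, so [natdiag_ext_eq0] applies. *)
Lemma natdiag_kernel_ext (K0 : has_pchar0 K) (c : 'I_n -> 'M[K]_n) (u : 'rV[L]_n) :
  (forall D, mxder (fun i => map_mx f (c i)) D -> natdiag D -> u *m D = 0) <->
  exists2 V : 'M[K]_n, forall A, mxder c A -> natdiag A -> V *m A = 0
                     & (u <= map_mx f V)%MS.
Proof.
have [V [VX xV uV]] := common_kernel (fun A => mxder c A /\ natdiag A).
have VX' A : mxder c A -> natdiag A -> V *m A = 0 by move=> dA nA; apply: VX.
split=> [uX|[V' V'X uV'] D dD nD].
  exists V => //; apply: uV => A [dA nA]; apply: uX; first exact: mxder_map.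
  exact: natdiag_map.
have V'V : (V' <= V)%MS.
  by apply/row_subP => i; apply: xV => A [dA nA]; rewrite -row_mul V'X // row0.
have /submxP[Z ->] : (u <= map_mx f V)%MS by rewrite (submx_trans uV') ?map_submx.
rewrite -mulmxA (natdiag_ext_eq0 K0 VX') ?mulmx0 // => A dA.
apply/row_subP => i; apply: xV => E [dE nE]; rewrite row_mul.
apply: (natdiag_kernel_stable K0) => // B dB nB.
by rewrite -row_mul VX' // row0.
Qed.

End BaseChange.

(** * Transfer between endomorphisms and matrices *)

Section Coordinates.
Variables (K : fieldType) (K0 : has_pchar0 K) (g : finLieType K) (n : nat).
Variables (phi : {linear g -> 'rV[K]_n}) (psi : 'rV[K]_n -> g).
Hypotheses (phiK : cancel phi psi) (psiK : cancel psi phi).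
Variable c : 'I_n -> 'M[K]_n.
Hypothesis phi_bracket : forall x y, phi [Lie x, y] = phi y *m mxad c (phi x).

Let phi_inj : injective phi := can_inj phiK.

Let psi_linear : linear psi.
Proof. by move=> a u v; apply: phi_inj; rewrite linearP !psiK. Qed.

Lemma mx_of_end (D : 'End(g)) : exists A : 'M[K]_n, forall x, phi (D x) = phi x *m A.
Proof.
exists (\matrix_i phi (D (psi (delta_mx 0 i)))) => x.
rewrite (@mulmx_funlin _ _ _ (fun u => phi (D (psi u)))) ?phiK //.
by move=> a u v; rewrite psi_linear !linearP.
Qed.

Lemma end_of_mx (A : 'M[K]_n) : exists D : 'End(g), forall x, phi (D x) = phi x *m A.
Proof.
pose h x := psi (phi x *m A).
have hl : linear h by move=> a x y; rewrite /h linearP mulmxDl -scalemxAl psi_linear.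
pose hA := GRing.isLinear.Build _ _ _ _ h hl.
pose hL : {linear g -> g} := HB.pack h hA.
by exists (linfun hL) => x; rewrite lfunE /= /h psiK.
Qed.

Variables (D : 'End(g)) (A : 'M[K]_n) (DA : forall x, phi (D x) = phi x *m A).

Lemma derivation_mxder : derivation D <-> mxder c A.
Proof.
rewrite mxderP; split=> [dD u|dA x y].
  have H x y : phi y *m mxad c (phi x) *m A
      = phi y *m A *m mxad c (phi x) + phi y *m mxad c (phi x *m A).
    by rewrite -!DA -!phi_bracket -DA dD (linearD phi) addrC.
  apply/row_matrixP => i; rewrite !rowE -(psiK (delta_mx 0 i)) -(psiK u).
  by rewrite mulmxDr !mulmxA H.
apply: phi_inj; rewrite DA phi_bracket -mulmxA dA (linearD phi) !phi_bracket !DA.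
by rewrite mulmxDr !mulmxA addrC.
Qed.

Lemma span_free_subseq (s : seq g) : exists t : seq g,
  [/\ {subset t <= s}, free t & (<<s>> <= <<t>>)%VS].
Proof.
elim: s => [|x s [t [ts ft st]]]; first by exists [::]; rewrite nil_free subvv.
have [xt|xt] := boolP (x \in <<t>>%VS).
  exists t; split=> //; first by move=> y /ts ys; rewrite inE ys orbT.
  by rewrite span_cons subv_add -memvE xt.
exists (x :: t); split; last by rewrite !span_cons addvS.
  by move=> y; rewrite !inE => /orP[->//|/ts ->]; rewrite orbT.
by rewrite free_cons xt.
Qed.

Lemma natdiag_end : (diagonalizable_end D /\ nat_eigenvalues D) <-> natdiag A.
Proof.
split=> [[[b bas bD] nD]|[N AN]].
  have nat_b x : x \in (b : seq g) -> exists m : nat, D x = m%:R *: x.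
    move=> xb; have [a Dx] := bD x xb; have [|m am] := nD a; last by exists m; rewrite -am.
    rewrite /passmx.leigenvalue; apply: contraTneq (free_not0 (basis_free bas) xb) => e.
    have : x \in passmx.leigenspace D a.
      by rewrite memv_ker add_lfunE opp_lfunE scale_lfunE id_lfunE Dx subrr.
    by rewrite e memv0 negbK.
  have [N NP] : exists N, forall x, x \in (b : seq g) -> exists2 m, (m < N)%N & D x = m%:R *: x.
    elim: (b : seq g) nat_b => [|x s IH] h; first by exists 0%N.
    have [|N NP] := IH; first by move=> y ys; apply: h; rewrite inE ys orbT.
    have [m Dx] := h x (mem_head _ _); exists (maxn m.+1 N) => y.
    rewrite inE => /predU1P[->|/NP[k kN Dy]]; first by exists m; rewrite // leq_maxl.
    by exists k => //; rewrite (leq_trans kN) // leq_maxr.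
  exists N; apply/row_matrixP => i; rewrite rowE row0 -(psiK (delta_mx 0 i)).
  rewrite (coord_basis bas (memvf (psi _))) linear_sum mulmx_suml big1 // => j _.
  have jb : b`_j \in (b : seq g) by rewrite mem_nth // size_tuple.
  have [m mN Dj] := NP _ jb.
  rewrite linearZ /= -scalemxAl (mxeval_eigenr (a := m%:R)).
    by rewrite natpoly_root // scale0r scaler0.
  by rewrite -DA Dj linearZ.
split; last first.
  move=> a; rewrite /passmx.leigenvalue => Ea.
  have := memv_pick (passmx.leigenspace D a); set v := vpick _ => Dv.
  have v0 : v != 0 by rewrite vpick0.
  have Av : phi v *m A = a *: phi v.
    rewrite -DA -linearZ; congr (phi _); apply/eqP.
    by move: Dv; rewrite memv_ker add_lfunE opp_lfunE scale_lfunE id_lfunE subr_eq0.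
  have := mxeval_eigenr (natpoly K N) Av; rewrite AN mulmx0 => /esym/eqP.
  rewrite scaler_eq0 -(linear0 phi) (inj_eq phi_inj) (negPf v0) orbF.
  rewrite horner_prod prodf_seq_eq0 => /hasP[i _ /=].
  by rewrite hornerXsubC subr_eq0 => /eqP ->; exists i.
have [l [l1 lN]] := natpoly_idempotents K0 N.
pose P i := mxeval A (l i).
have P1 : \sum_(i < N) P i = 1%:M.
  exact: mxeval_partition AN l1.
have PA i : (i < N)%N -> P i *m A = i%:R *: P i.
  by move=> iN; rewrite mxeval_commX; apply: mxeval_XsubC_eigen AN (lN i iN).
(* The rows of the projectors are eigenvectors or zero, and they span, so a basis can be extracted
   from them. *)
pose s := [seq psi (row k (P (i : nat))) | i : 'I_N <- enum 'I_N, k : 'I_n <- enum 'I_n].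
have [t [ts ft st]] := span_free_subseq s.
have full : (<<t>> = fullv)%VS.
  apply/eqP; rewrite eqEsubv subvf /=; apply: subv_trans st; apply/subvP => x _.
  rewrite -(phiK x) -(mulmx1 (phi x)) -P1 mulmx_sumr.
  have psi_sum (I : finType) (F : I -> 'rV_n) : psi (\sum_i F i) = \sum_i psi (F i).
    apply: phi_inj; rewrite psiK linear_sum; apply: eq_bigr => i _; by rewrite psiK.
  rewrite psi_sum; apply: memv_suml => i _; rewrite mulmx_sum_row psi_sum.
  apply: memv_suml => k _.
  have -> : psi (phi x 0 k *: row k (P i)) = phi x 0 k *: psi (row k (P i)).
    by apply: phi_inj; rewrite linearZ /= !psiK.
  apply: memvZ; apply: memv_span; apply/allpairsP; exists (i, k).
  by rewrite !mem_enum.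
have bt : basis_of fullv t by rewrite basisEfree ft full subvf /= -full (eqP ft).
have st' : size t == \dim {:g} by rewrite -full (eqP ft).
exists (Tuple st') => // x /ts /allpairsP[[i k] [_ _ ->]]; exists i%:R.
by apply: phi_inj; rewrite DA linearZ /= psiK -row_mul PA // linearZ.
Qed.

End Coordinates.

Lemma cni_plusP (K : fieldType) (K0 : has_pchar0 K) (g : finLieType K) n
    (phi : {linear g -> 'rV[K]_n}) (psi : 'rV[K]_n -> g) (c : 'I_n -> 'M[K]_n) (x : g) :
    cancel phi psi -> cancel psi phi ->
    (forall x y, phi [Lie x, y] = phi y *m mxad c (phi x)) ->
  cni_plus g x <-> forall A, mxder c A -> natdiag A -> phi x *m A = 0.
Proof.
move=> phiK psiK phiB; split=> [xD A dA nA|xA D [dD diD nD]].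
  have [D DA] := end_of_mx phiK psiK A.
  have [di ne] : diagonalizable_end D /\ nat_eigenvalues D.
    exact/(natdiag_end K0 phiK psiK DA).
  have dD : derivation D by apply/(derivation_mxder phiK psiK phiB DA).
  have /= := xD D (And3 dD di ne); rewrite memv_ker -DA => /eqP ->.
  exact: linear0.
have [A DA] := mx_of_end phiK psiK D.
rewrite /= memv_ker; apply/eqP/(can_inj phiK); rewrite DA linear0.
apply: xA; first exact/(derivation_mxder phiK psiK phiB DA).
exact/(natdiag_end K0 phiK psiK DA).
Qed.

(** * Coordinates on the Lie algebra and on its extension *)

Section LieCoordinates.
Variables (K L : fieldType) (f : {rmorphism K -> L}) (g : finLieType K).
Local Notation n := (\dim {:g}).

Definition coords (x : g) : 'rV[K]_n := \row_i coord (vbasis {:g}) i x.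

Definition of_coords (u : 'rV[K]_n) : g := \sum_i u 0 i *: gbasis i.

Lemma coords_linear : linear coords.
Proof. by move=> a x y; apply/rowP => i; rewrite !mxE linearP. Qed.

HB.instance Definition _ := GRing.isLinear.Build K g 'rV[K]_n *:%R coords coords_linear.

Lemma coordsK : cancel coords of_coords.
Proof. by move=> x; rewrite [RHS]gbasisE; apply: eq_bigr => i _; rewrite mxE. Qed.

Lemma of_coordsK : cancel of_coords coords.
Proof.
move=> u; rewrite [RHS]row_sum_delta linear_sum; apply: eq_bigr => i _.
by rewrite linearZ; congr (_ *: _); apply/rowP => j; rewrite !mxE coord_gbasis.
Qed.

Definition adbasis (i : 'I_n) : 'M[K]_n := \matrix_k coords [Lie gbasis i, gbasis k].

Lemma coords_bracket x y : coords [Lie x, y] = coords y *m mxad adbasis (coords x).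
Proof.
rewrite mxadE mulmx_sumr [in LHS](gbasisE x) linear_sumlz linear_sum.
apply: eq_bigr => i _; rewrite linearZl_LR linearZ -scalemxAr mxE; congr (_ *: _).
rewrite mulmx_sum_row [in LHS](gbasisE y) linear_sumr linear_sum.
by apply: eq_bigr => k _; rewrite linearZr_LR linearZ rowK mxE.
Qed.

Lemma tens_coords a (x : g) : tens f a x = a *: map_mx f (coords x).
Proof. by apply/rowP => i; rewrite !mxE. Qed.

(** Elements of [scalar_ext f g] are already coordinate rows; the named identity carries the linear
    structure required by [cni_plusP]. *)
Definition ext_coords (u : scalar_ext f g) : 'rV[L]_n := u.

HB.instance Definition _ := GRing.isLinear.Build L (scalar_ext f g) 'rV[L]_n *:%R
  ext_coords (fun _ _ _ => erefl).

Lemma ext_coords_bracket (u v : scalar_ext f g) : ext_coords [Lie u, v]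
  = ext_coords v *m mxad (fun i => map_mx f (adbasis i)) (ext_coords u).
Proof.
rewrite mxadE mulmx_sumr; apply: eq_bigr => i _.
rewrite -scalemxAr mulmx_sum_row scaler_sumr; apply: eq_bigr => k _.
by rewrite -map_row rowK tens_coords scalerA.
Qed.

End LieCoordinates.

(** * Comparison of the two radicals *)

Theorem theorem1p7 (K L : fieldType) (f : {rmorphism K -> L}) (g : finLieType K)
    (charK : has_pchar0 K) :
  cni_plus (scalar_ext f g) = ext_subspace f (cni_plus g) /\
  (essentially_contractable g <->
     essentially_contractable (scalar_ext f g)).
Proof.
have L0 : has_pchar0 L by move=> p; rewrite (fmorph_pchar f); apply: charK.
pose X (x : g) := forall A, mxder (@adbasis K g) A -> natdiag A -> coords x *m A = 0.
have cniK x : cni_plus g x <-> X x.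
  exact: (cni_plusP charK (phi := @coords K g) x (@coordsK _ _) (@of_coordsK _ _)
    (@coords_bracket _ _)).
have cniL (u : scalar_ext f g) : cni_plus (scalar_ext f g) u <->
    exists2 V : 'M[K]_(\dim {:g}),
      forall A, mxder (@adbasis K g) A -> natdiag A -> V *m A = 0
    & ((u : 'rV[L]_(\dim {:g})) <= map_mx f V)%MS.
  rewrite -(natdiag_kernel_ext _ charK).
  apply: (cni_plusP L0 (phi := @ext_coords K L f g) (psi := id)) => //.
  exact: ext_coords_bracket.
have eq_cni : cni_plus (scalar_ext f g) = ext_subspace f (cni_plus g).
  apply/predeqP => u; split=> [/cniL [V VX /submxP [y uV]]|[s sX ->]].
    (* The rows of [V] give elements of the radical of [g], and [y] their coefficients in [L]. *)
    exists [seq (y 0 i, of_coords (row i V)) | i <- enum 'I_(\dim {:g})].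
      move=> _ /mapP[i _ ->] /=; apply/cniK => A dA nA.
      by rewrite of_coordsK -row_mul VX // row0.
    rewrite big_map big_enum /= uV mulmx_sum_row; apply: eq_bigr => i _.
    by rewrite tens_coords of_coordsK map_row.
  (* A single [V] must serve for all elements of [s], so the full common kernel is taken. *)
  have [V [VX xV _]] := common_kernel f (fun A => mxder (@adbasis K g) A /\ natdiag A).
  apply/cniL; exists V; first by move=> A dA nA; apply: VX.
  elim: s sX => [|p s IH] sX; first by rewrite big_nil sub0mx.
  rewrite big_cons; apply: addmx_sub; last by apply: IH => q qs; apply: sX; rewrite inE qs orbT.
  rewrite tens_coords scalemx_sub // map_submx; apply: xV => A [dA nA].
  by have /cniK := sX p (mem_head _ _); apply.
split=> //; rewrite /essentially_contractable eq_cni.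
split=> [->|ext0].
  apply/predeqP => u; split=> [[s s0 ->]|->]; last by exists [::]; rewrite ?big_nil.
  by rewrite big_seq big1 // => p /s0 ->; apply: tens0r.
apply/predeqP => x; split=> [xg|->]; last by apply/cniK => A _ _; rewrite linear0 mul0mx.
(* An element [x] of the radical of [g] gives [tens f 1 x] in that of the extension, and [tens f 1]
   is injective. *)
have : ext_subspace f (cni_plus g) (tens f 1 x).
  exists [:: (1, x)]; last by rewrite big_seq1.
  by move=> p; rewrite inE => /eqP ->.
rewrite ext0 tens_coords scale1r => /= e.
apply: (can_inj (@coordsK K g)); rewrite linear0; apply: (map_mx_inj (f := f)).
by rewrite map_mx0.
Qed.
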